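(* Let $j$ be a positive integer and consider $n=2j$ qubits. Run the following procedure (Algorithm 1): initialize all $2j$ qubits to $|0\rangle$ and set $m=j$; while $m\neq 0$, (i) apply the collective rotation $\exp(-i\theta_m J_y)$ with $\theta_m=\arcsin(m/j)$, (ii) perform a projective measurement of $J_z$ and set $m$ to the outcome, (iii) if $|m|>\sqrt{j}$, reset all qubits to $|0\rangle$ and set $m=j$. Then the procedure terminates with the system in the Dicke state $|j,0\rangle$, and the expected number of iterations of the while-loop is $O(\log j)$ as $j\to\infty$.
   Context: For $n$ qubits viewed as spin-$\tfrac12$ particles, let $\mathbf S_k$ be the spin operator of qubit $k$ and $\mathbf J=\sum_{k=1}^n \mathbf S_k$, with components $J_x,J_y,J_z$. The state $|0\rangle$ is spin up ($S_z=+\tfrac12$) and $|1\rangle$ is spin down. The Dicke state $|j,m\rangle$ (with $j=n/2$, $m\in\{-j,\dots,j\}$) is the uniform (equal-amplitude, normalized) superposition of all $n$-bit computational basis strings of Hamming weight $w=j-m$; it is a simultaneous eigenstate of $\mathbf J^2$ (eigenvalue $j(j+1)$) and $J_z$ (eigenvalue $m$). In particular $|j,j\rangle=|0\rangle^{\otimes n}$. A projective $J_z$ measurement on a permutation-symmetric state $\sum_m c_m|j,m\rangle$ yields outcome $m$ with probability $|c_m|^2$ and leaves the state $|j,m\rangle$. Each iteration of the while-loop counts as one unit of time. *)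

(* Defs.v *)
From HB Require Import structures.
From mathcomp Require Import all_boot all_order all_algebra.
From mathcomp Require Import complex.
From mathcomp Require Import all_classical all_reals all_analysis.

Set Implicit Arguments.
Unset Strict Implicit.
Unset Printing Implicit Defensive.

Import Order.TTheory GRing.Theory Num.Theory numFieldNormedType.Exports.
Local Open Scope ring_scope.
Local Open Scope complex_scope.

Section Qubits.
Variable R : realType.
Local Notation C := R[i].

(* The computational basis of n qubits is indexed by x : 'I_(2^n); the state
   of qubit k in basis string x is bit k of x: false = |0> (spin up),
   true = |1> (spin down). *)
Definition qbit (n : nat) (x : 'I_(2 ^ n)) (k : 'I_n) : bool := odd (x %/ 2 ^ k).

Definition hweight (n : nat) (x : 'I_(2 ^ n)) : nat := #|[set k : 'I_n | qbit x k]|.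

(* single-qubit spin matrices S = sigma/2 in the basis |0>,|1>
   (row index = output bit, column index = input bit) *)
Definition sy1 (a b : bool) : C :=
  match a, b with
  | false, true => - ('i / 2%:R)
  | true, false => 'i / 2%:R
  | _, _ => 0
  end.
Definition sz1 (a b : bool) : C :=
  match a, b with
  | false, false => (1 / 2%:R)
  | true, true => - (1 / 2%:R)
  | _, _ => 0
  end.

Definition on_qubit (n : nat) (s1 : bool -> bool -> C) (k : 'I_n) : 'M[C]_(2 ^ n) :=
  \matrix_(x, y) (if [forall l : 'I_n, (l != k) ==> (qbit x l == qbit y l)]
                  then s1 (qbit x k) (qbit y k) else 0).

Definition Jy (n : nat) : 'M[C]_(2 ^ n) := \sum_(k < n) on_qubit sy1 k.
Definition Jz (n : nat) : 'M[C]_(2 ^ n) := \sum_(k < n) on_qubit sz1 k.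

Definition mxpow (N : nat) (M : 'M[C]_N) (k : nat) : 'M[C]_N := iter k (mulmx M) 1%:M.
Definition expmx_partial (N : nat) (M : 'M[C]_N) (K : nat) : 'M[C]_N :=
  \sum_(k < K) (k`!%:R)^-1 *: mxpow M k.
Definition expmx (N : nat) (M : 'M[C]_N) : 'M[C]_N :=
  \matrix_(a, b) ((limn (fun K => complex.Re (expmx_partial M K a b)))
                  +i* (limn (fun K => complex.Im (expmx_partial M K a b)))).

Definition rotY (n : nat) (theta : R) : 'M[C]_(2 ^ n) :=
  expmx ((- ('i * theta%:C)) *: Jy n).

Definition dicke_w (n w : nat) : 'cV[C]_(2 ^ n) :=
  \col_x (if hweight x == w then ((Num.sqrt ('C(n, w))%:R)^-1)%:C else 0).
Definition dicke (j : nat) (m : int) : 'cV[C]_(2 ^ (2 * j)) :=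
  dicke_w (2 * j) `|j%:Z - m|%N.

Definition absq (z : C) : R := complex.Re z ^+ 2 + complex.Im z ^+ 2.
Definition projJz (n : nat) (m : int) (psi : 'cV[C]_(2 ^ n)) : 'cV[C]_(2 ^ n) :=
  \col_x (if Jz n x x == m%:~R then psi x 0 else 0).
Definition probJz (n : nat) (m : int) (psi : 'cV[C]_(2 ^ n)) : R :=
  \sum_x absq (projJz m psi x 0).

Definition theta (j : nat) (m : int) : R := asin (m%:~R / j%:R).

Definition rotated (j : nat) (m : int) : 'cV[C]_(2 ^ (2 * j)) :=
  rotY (2 * j) (theta j m) *m dicke j m.

Definition reset_rule (j : nat) (m : int) : int :=
  if Num.sqrt (j%:R : R) < (`|m|%:~R : R) then j%:Z else m.

Definition mval (j : nat) (i : 'I_(2 * j).+1) : int := i%:Z - j%:Z.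

Definition trans (j : nat) (m m' : int) : R :=
  \sum_(i < (2 * j).+1 | reset_rule j (mval i) == m') probJz (mval i) (rotated j m).

(* sub-probability distribution of m after t iterations, restricted to the runs
   that have not yet terminated (m has been nonzero at the start of each of the
   t iterations) *)
Fixpoint alive (j : nat) (t : nat) (m' : int) : R :=
  match t with
  | 0 => if m' == j%:Z then 1 else 0
  | t.+1 => \sum_(i < (2 * j).+1 | mval i != 0)
              alive j t (mval i) * trans j (mval i) m'
  end.

(* P(T > t), where T is the number of while-loop iterations *)
Definition surv (j t : nat) : R := \sum_(i < (2 * j).+1 | mval i != 0) alive j t (mval i).

(* E[T] = sum_{t >= 0} P(T > t), as an extended real *)
Definition expected_iterations (j : nat) : \bar R :=
  (\sum_(0 <= t <oo) (surv j t)%:E)%E.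

End Qubits.

(* Main.v *)
(** For sin(theta) = m/j the outcome m' has mean m cos(theta) and, as j grows with
    m^2 <= j, central moments m^2/2, 0 and 3 m^4/8 + m^2/2 of orders 2, 3, 4: m'/m - 1
    spreads like cos(phi) with phi uniform.  A quartic majorant of the cube root turns
    these four exact moments into E |m'|^(1/3) <= (249/250) |m|^(1/3) whenever
    0 < |m| <= sqrt j, and the second moment j/2 of the first measurement gives
    E |m'|^(1/3) <= (11/12) (sqrt j)^(1/3) after a reset.  Hence
    a ln (1 + |m|^(1/3)) + B (|m| / sqrt j)^(1/3) for |m| <= sqrt j, extended by the
    constant B of order ln j, decreases by at least 1 on average in each iteration.

    The moments come from the Heisenberg picture: the rotation is a tensor power of a
    2x2 rotation and conjugates Jz into cos(theta) Jz - sin(theta) Jx, which acts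
    tridiagonally on functions of the Hamming weight. *)

Require Import Defs.
From HB Require Import structures.
From mathcomp Require Import all_boot all_order all_algebra.
From mathcomp Require Import complex.
From mathcomp Require Import all_classical all_reals all_analysis.
From mathcomp Require Import ring lra zify.
Import Order.TTheory GRing.Theory Num.Theory numFieldNormedType.Exports.
Set Implicit Arguments.
Unset Strict Implicit.
Unset Printing Implicit Defensive.
Local Open Scope ring_scope.
Local Open Scope complex_scope.

(** * Bit strings and tensor products *)

Lemma nat_bits_inj n x y : (x < 2 ^ n)%N -> (y < 2 ^ n)%N ->
  (forall k, (k < n)%N -> odd (x %/ 2 ^ k) = odd (y %/ 2 ^ k)) -> x = y.
Proof.
elim: n x y => [|n IH] x y; first by rewrite expn0 !ltnS !leqn0 => /eqP-> /eqP->.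
move=> hx hy H; have H0 := H 0%N isT; rewrite expn0 !divn1 in H0.
have E : x./2 = y./2.
  apply: IH; rewrite -?divn2 ?ltn_divLR // -?expnSr // => k hk.
  by rewrite -!divnMA -!expnS; exact: H.
by rewrite -(odd_double_half x) -(odd_double_half y) H0 E.
Qed.

Definition bits (n : nat) (x : 'I_(2 ^ n)) : {ffun 'I_n -> bool} :=
  [ffun k => qbit x k].

Lemma bits_inj n : injective (@bits n).
Proof.
move=> x y /ffunP H; apply/val_inj; apply: (nat_bits_inj (ltn_ord x) (ltn_ord y)) => k hk.
by have := H (Ordinal hk); rewrite !ffunE.
Qed.

Lemma bits_bij n : bijective (@bits n).
Proof.
apply: inj_card_bij; first exact: bits_inj.
by rewrite card_ffun card_bool !card_ord.
Qed.

Lemma bits_surj n (b : 'I_n -> bool) : exists x : 'I_(2 ^ n), forall k, qbit x k = b k.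
Proof.
have [g _ gK] := bits_bij n; exists (g (finfun b)) => k.
by have /ffunP/(_ k) := gK (finfun b); rewrite !ffunE.
Qed.

Lemma hweightE n (x : 'I_(2 ^ n)) : hweight x = (\sum_(k < n) qbit x k)%N.
Proof. by rewrite /hweight -sum1dep_card big_mkcond /=. Qed.

Lemma hweight_le n (x : 'I_(2 ^ n)) : (hweight x <= n)%N.
Proof. by rewrite -[X in (_ <= X)%N](card_ord n); exact: max_card. Qed.

Lemma card_hweight n w : #|[set x : 'I_(2 ^ n) | hweight x == w]| = 'C(n, w).
Proof.
rewrite -[in RHS](card_ord n) -card_draws.
have inj : injective (fun x : 'I_(2 ^ n) => [set k | qbit x k]).
  move=> x y /finset.setP H; apply: bits_inj; apply/ffunP => k.
  by have := H k; rewrite !inE !ffunE.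
rewrite -(card_imset _ inj); apply: eq_card => A; rewrite inE.
apply/imsetP/eqP => [[x]|hA]; first by rewrite inE /hweight => /eqP <- ->.
have [x hx] := bits_surj (fun k => k \in A).
have E : A = [set k | qbit x k] by apply/finset.setP => k; rewrite inE hx.
by exists x => //; rewrite inE /hweight -E hA.
Qed.

Section Tensor.
Variable K : comNzRingType.
Implicit Types r s : bool -> bool -> K.

(** Entry formula for the Kronecker product of n one-qubit matrices, read off bit by bit. One-qubit
    matrices are functions of two bits, in the format of [sy1] and [sz1]. *)
Definition tens n (r : 'I_n -> bool -> bool -> K) : 'M[K]_(2 ^ n) :=
  \matrix_(x, y) \prod_l r l (qbit x l) (qbit y l).

Definition mul2 r s (a b : bool) : K := \sum_d r a d * s d b.
Definition id2 (a b : bool) : K := (a == b)%:R.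
Definition at_qubit n (k : 'I_n) s (l : 'I_n) := if l == k then s else id2.

Lemma mul2E r s a b : mul2 r s a b = r a true * s true b + r a false * s false b.
Proof. by rewrite /mul2 big_bool. Qed.

Lemma mul2_id r a b : mul2 r id2 a b = r a b.
Proof. by rewrite mul2E /id2; case: b; rewrite /= ?mulr0 ?mulr1 ?addr0 ?add0r. Qed.

Lemma mul2_idl r a b : mul2 id2 r a b = r a b.
Proof. by rewrite mul2E /id2; case: a; rewrite /= ?mul0r ?mul1r ?addr0 ?add0r. Qed.

Lemma eq_tens n (r s : 'I_n -> bool -> bool -> K) :
  (forall l a b, r l a b = s l a b) -> tens r = tens s.
Proof. by move=> H; apply/matrixP => x y; rewrite !mxE; apply: eq_bigr. Qed.

Lemma sum_bits n (F : 'I_n -> bool -> K) :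
  \sum_(z : 'I_(2 ^ n)) \prod_l F l (qbit z l) = \prod_l \sum_d F l d.
Proof.
rewrite bigA_distr_bigA /= (reindex (@bits n)) /=; last exact: onW_bij (bits_bij n).
by apply: eq_bigr => z _; apply: eq_bigr => l _; rewrite ffunE.
Qed.

Lemma tens_mul n (r s : 'I_n -> bool -> bool -> K) :
  tens r *m tens s = tens (fun l => mul2 (r l) (s l)).
Proof.
apply/matrixP => x y; rewrite !mxE -sum_bits.
by apply: eq_bigr => z _; rewrite !mxE -big_split.
Qed.

Lemma tens_id n : tens (fun _ : 'I_n => id2) = 1%:M.
Proof.
apply/matrixP => x y; rewrite !mxE; case: eqVneq => [->|neq].
  by apply: big1 => l _; rewrite /id2 eqxx.
have [k hk] : exists k, qbit x k != qbit y k.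
  apply/existsP; rewrite -negb_forall; apply: contra neq => /forallP H.
  by apply/eqP/bits_inj/ffunP => k; rewrite !ffunE; apply/eqP.
by rewrite (bigD1 k) //= /id2 (negbTE hk) mul0r.
Qed.

Lemma tens_at n (k : 'I_n) s (x y : 'I_(2 ^ n)) :
  tens (at_qubit k s) x y =
  if [forall l : 'I_n, (l != k) ==> (qbit x l == qbit y l)]
  then s (qbit x k) (qbit y k) else 0.
Proof.
rewrite mxE (bigD1 k) //= {1}/at_qubit eqxx.
case: ifPn => [/forallP H|/forallPn [l]].
  rewrite big1 ?mulr1 // => l hl; rewrite /at_qubit (negbTE hl) /id2.
  by have /implyP/(_ hl)-> := H l.
rewrite negb_imply => /andP [hl hxy].
by rewrite (bigD1 l) //= /at_qubit (negbTE hl) /id2 (negbTE hxy) mul0r mulr0.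
Qed.

Definition collective n s : 'M[K]_(2 ^ n) := \sum_(k < n) tens (at_qubit k s).

(** On qubit k this is the one-qubit hypothesis; on every other qubit both sides carry the factor r,
    since the identity commutes with it. *)
Lemma collective_tens n s s' r :
  (forall a b, mul2 s r a b = mul2 r s' a b) ->
  collective n s *m tens (fun _ => r) = tens (fun _ => r) *m collective n s'.
Proof.
move=> H; rewrite mulmx_suml mulmx_sumr; apply: eq_bigr => k _.
rewrite !tens_mul; apply: eq_tens => l a b; rewrite /at_qubit; case: eqP => // _.
by rewrite mul2_id mul2_idl.
Qed.

End Tensor.

(** * Taylor expansion *)

Section Taylor.
Variable R : realType.

Lemma is_derive_exprB n (t : R) :
  is_derive t (1 : R) (fun u => (1 - u) ^+ n.+1 / n.+1`!%:R) (- ((1 - t) ^+ n / n`!%:R)).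
Proof.
have h1 : (n.+1%:R : R) != 0 by rewrite pnatr_eq0.
have h2 : (n`!%:R : R) != 0 by rewrite pnatr_eq0 -lt0n fact_gt0.
pose p : {poly R} := n.+1`!%:R^-1 *: (1 - 'X) ^+ n.+1.
have -> : (fun u => (1 - u) ^+ n.+1 / n.+1`!%:R) = horner p.
  by apply/funext => u; rewrite /p !hornerE mulrC.
apply: is_derive_eq (is_derive_poly p t) _.
rewrite /p derivZ deriv_exp derivB derivC derivX sub0r /= !hornerE factS natrM.
by rewrite hornerMn !hornerE -mulr_natl; field; rewrite h2 nat1r h1.
Qed.

(* The derivative telescopes: half of that of each term cancels against the next term. *)
Lemma is_derive_taylor_rem (g : nat -> R -> R) (K : nat) (t : R) :
  (forall k (u : R), is_derive u 1 (g k) (g k.+1 u)) ->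
  is_derive t 1 (fun u => \sum_(k < K.+1) (1 - u) ^+ k / k`!%:R * g k u)
    ((1 - t) ^+ K / K`!%:R * g K.+1 t).
Proof.
move=> dg; elim: K => [|K IH].
  rewrite [X in is_derive _ _ X _](_ : _ = g 0%N).
    by rewrite expr0 fact0 divr1 mul1r; exact: dg.
  by apply/funext => u; rewrite big_ord1 expr0 fact0 divr1 mul1r.
rewrite [X in is_derive _ _ X _](_ : _ =
  (fun u => \sum_(k < K.+1) (1 - u) ^+ k / k`!%:R * g k u) +
  (fun u => (1 - u) ^+ K.+1 / K.+1`!%:R) * g K.+1); last first.
  by apply/funext => u; rewrite big_ord_recr.
apply: is_derive_eq (is_deriveD IH (is_deriveM (is_derive_exprB K t) (dg K.+1 t))) _.
by rewrite /GRing.scale /=; ring.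
Qed.

(** Here [g k] is the k-th derivative of [g 0]. The Taylor polynomial based at u and evaluated at 1,
    viewed as a function of u, runs from the partial sum at u = 0 to [g 0 1] at u = 1. By the mean
    value theorem its increment is at most B^(K+1) / K!. *)
Lemma taylor_cvg (g : nat -> R -> R) (B : R) :
  (forall k (u : R), is_derive u 1 (g k) (g k.+1 u)) ->
  (forall k u, `|g k u| <= B ^+ k) ->
  ((fun K => \sum_(k < K) (k`!%:R)^-1 * g k 0) @ \oo --> g 0%N 1)%classic.
Proof.
move=> dg hg; rewrite -(cvg_shiftn 1).
have B0 : 0 <= B by rewrite -[B]expr1; exact: le_trans (hg 1%N 0).
have hB : ((fun K => B * exp_coeff B K) @ \oo --> (0 : R))%classic.
  by rewrite -[0](mulr0 B); apply: cvgM; [exact: cvg_cst | exact: cvg_exp_coeff].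
apply/cvgrPdist_le => /= e e0.
have /cvgrPdist_le/(_ _ e0) := hB.
apply: filterS => K /=; rewrite sub0r normrN => hK; apply: le_trans hK.
rewrite addn1.
pose phi := fun u => \sum_(k < K.+1) (1 - u) ^+ k / k`!%:R * g k u.
have E1 : phi 1 = g 0%N 1.
  rewrite /phi big_ord_recl big1 ?addr0; first by rewrite expr0 fact0 divr1 mul1r.
  by move=> i _; rewrite subrr expr0n /= !mul0r.
have E0 : phi 0 = \sum_(k < K.+1) (k`!%:R)^-1 * g k 0.
  by apply: eq_bigr => i _; rewrite subr0 expr1n mul1r.
rewrite -E0 -E1.
have dphi u : is_derive u (1 : R) phi ((1 - u) ^+ K / K`!%:R * g K.+1 u).
  exact: is_derive_taylor_rem.
have [|c] := @MVT_segment R phi _ 0 1 ler01 (fun u _ => dphi u).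
  apply: continuous_subspaceT => u; apply: differentiable_continuous.
  by apply/derivable1_diffP; case: (dphi u).
rewrite in_itv /= => /andP [c0 c1] ->.
rewrite subr0 mulr1 /exp_coeff /= !normrM !normfV !normrX !normr_nat (ger0_norm B0).
rewrite [leRHS](_ : _ = 1 / K`!%:R * B ^+ K.+1); last by rewrite exprS; ring.
apply: ler_pM; rewrite ?divr_ge0 ?exprn_ge0 //.
apply: ler_wpM2r; first by rewrite invr_ge0.
by apply: exprn_ile1; rewrite ?normr_ge0 // ger0_norm; lra.
Qed.

(** Leibniz rule in the form that matches an operator acting on one qubit of a tensor product. *)
Lemma is_derive_prod n (f : 'I_n -> R -> R) (df : 'I_n -> R) (t : R) :
  (forall l, is_derive t 1 (f l) (df l)) ->
  is_derive t 1 (fun u => \prod_(l < n) f l u)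
    (\sum_(k < n) \prod_(l < n) (if l == k then df l else f l t)).
Proof.
elim: n f df => [|n IH] f df H.
  rewrite big_ord0 [X in is_derive _ _ X _](_ : _ = cst 1); first exact: is_derive_cst.
  by apply/funext => u; rewrite big_ord0.
rewrite [X in is_derive _ _ X _](_ : _ =
  f ord0 * (fun u => \prod_(l < n) f (lift ord0 l) u)); last first.
  by apply/funext => u; rewrite big_ord_recl.
have D := IH (fun l => f (lift ord0 l)) (fun l => df (lift ord0 l)) (fun l => H (lift ord0 l)).
apply: is_derive_eq (is_deriveM (H ord0) D) _.
rewrite [RHS]big_ord_recl addrC /GRing.scale /=; congr (_ + _).
  by rewrite [in RHS]big_ord_recl eqxx mulrC.
by rewrite mulr_sumr; apply: eq_bigr => k _; rewrite [in RHS]big_ord_recl.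
Qed.

End Taylor.

(** * The collective rotation *)

Section Rotation.
Variable R : realType.

Definition mxiter (N : nat) (M : 'M[R]_N) (k : nat) : 'M[R]_N :=
  iter k (mulmx M) 1%:M.

Lemma mxiterSr N (M : 'M[R]_N) k : mxiter M k.+1 = mxiter M k *m M.
Proof.
by elim: k => [|k IH]; rewrite /= ?mulmx1 ?mul1mx // -mulmxA -IH.
Qed.

Lemma expmx_real N (M E : 'M[R]_N) :
  (forall a b, ((fun K => \sum_(k < K) (k`!%:R)^-1 * mxiter M k a b) @ \oo
     --> E a b)%classic) ->
  expmx (map_mx (real_complex R) M) = map_mx (real_complex R) E.
Proof.
move=> H; have P k : mxpow (map_mx (real_complex R) M) k
    = map_mx (real_complex R) (mxiter M k).
  by elim: k => [|k IH]; rewrite /mxpow /= ?map_mx1 // [iter _ _ _]IH map_mxM.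
have Q K a b : expmx_partial (map_mx (real_complex R) M) K a b
    = (\sum_(k < K) (k`!%:R)^-1 * mxiter M k a b)%:C.
  rewrite /expmx_partial summxE rmorph_sum; apply: eq_bigr => k _.
  by rewrite P !mxE rmorphM fmorphV rmorph_nat.
apply/matrixP => a b; rewrite !mxE.
under [X in limn X]eq_fun do rewrite Q.
under [X in _ +i* limn X]eq_fun do rewrite Q.
by rewrite (cvg_lim _ (H a b)) //= lim_cst.
Qed.

(* the real matrix -i S_y *)
Definition sy_real (a b : bool) : R :=
  match a, b with false, true => - (1 / 2) | true, false => 1 / 2 | _, _ => 0 end.

(** The one-qubit matrix exp(-i t S_y), a real rotation by the half angle. *)
Definition spin_rot (t : R) (a b : bool) : R :=
  match a, b with
  | false, true => - sin (t / 2)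
  | true, false => sin (t / 2)
  | _, _ => cos (t / 2)
  end.

Lemma rot_le1 t a b : `|spin_rot t a b| <= 1.
Proof.
by case: a; case: b; rewrite /= ?normrN ler_norml ?cos_geN1 ?cos_le1 ?sin_geN1 ?sin_le1.
Qed.

Lemma is_derive_rot (t u : R) a b :
  is_derive u 1 (fun v => spin_rot (t * v) a b) (t * mul2 sy_real (spin_rot (t * u)) a b).
Proof.
have D : is_derive u (1 : R) (fun v => t * v / 2) (t / 2).
  rewrite [X in is_derive _ _ X _](_ : _ = (t / 2) \*: id); last first.
    by apply/funext => v; rewrite /= /GRing.scale /=; ring.
  by apply: is_derive_eq (is_deriveZ _ (is_derive_id _ _)) _; rewrite /GRing.scale /= mulr1.
have Ds : is_derive u (1 : R) (fun v => sin (t * v / 2)) (t / 2 * cos (t * u / 2)).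
  by apply: is_derive_eq (is_derive1_comp (is_derive_sin _) D) _; rewrite /GRing.scale /= mulrC.
have Dc : is_derive u (1 : R) (fun v => cos (t * v / 2)) (- (t / 2 * sin (t * u / 2))).
  by apply: is_derive_eq (is_derive1_comp (is_derive_cos _) D) _; rewrite /GRing.scale /=; ring.
case: a; case: b; rewrite mul2E /=.
- by apply: is_derive_eq Dc _; field.
- by apply: is_derive_eq Ds _; field.
- by apply: is_derive_eq (is_deriveN Ds) _; field.
- by apply: is_derive_eq Dc _; field.
Qed.

Section Fixed.
Variables (n : nat) (t : R).

Let M : 'M[R]_(2 ^ n) := t *: collective n sy_real.
Let G (u : R) : 'M[R]_(2 ^ n) := tens (fun _ : 'I_n => spin_rot (t * u)).

(** The flow equation G' = M G: differentiating the factor of qubit k inserts -i S_y there, and the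
    sum over k is the collective operator. *)
Lemma is_derive_tens_rot (u : R) x y : is_derive u 1 (fun v => G v x y) ((M *m G u) x y).
Proof.
have D := @is_derive_prod R n (fun l v => spin_rot (t * v) (qbit x l) (qbit y l)) _ u
  (fun l => is_derive_rot t u (qbit x l) (qbit y l)).
rewrite [X in is_derive _ _ X _](_ : _ =
  fun v => \prod_(l < n) spin_rot (t * v) (qbit x l) (qbit y l)).
  apply: is_derive_eq D _.
  rewrite -scalemxAl mxE mulmx_suml summxE mulr_sumr; apply: eq_bigr => k _.
  rewrite tens_mul mxE (bigD1 k) //= [in RHS](bigD1 k) //= eqxx -mulrA; congr (_ * (_ * _)).
    by rewrite /at_qubit eqxx.
  by apply: eq_bigr => l /negbTE hl; rewrite /at_qubit hl mul2_idl.
by apply/funext => v; rewrite mxE.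
Qed.

Let g x y k u := (mxiter M k *m G u) x y.

Lemma is_derive_mxiter x y k (u : R) : is_derive u 1 (g x y k) (g x y k.+1 u).
Proof.
rewrite [X in is_derive _ _ X _](_ : _ =
  \sum_(z < 2 ^ n) (mxiter M k x z \*: (fun v => G v z y))); last first.
  by apply/funext => v; rewrite /g mxE fct_sumE.
apply: is_derive_eq (is_derive_sum (fun z => is_deriveZ _ (is_derive_tens_rot u z y))) _.
by rewrite /g mxiterSr -mulmxA mxE.
Qed.

(** Entries of G are at most 1 in absolute value, and each factor M costs at most the sum of all its
    absolute entries. This is the geometric bound asked for by [taylor_cvg]. *)
Lemma mxiter_bound x y k u : `|g x y k u| <= (\sum_a \sum_b `|M a b|) ^+ k.
Proof.
elim: k x => [|k IH] x.
  rewrite /g mul1mx mxE normr_prod expr0; apply: prodr_ile1 => l _.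
  by rewrite normr_ge0 rot_le1.
rewrite /g /= -mulmxA mxE exprS; apply: le_trans (ler_norm_sum _ _ _) _.
apply: (@le_trans _ _ (\sum_b `|M x b| * (\sum_a \sum_b `|M a b|) ^+ k)).
  by apply: ler_sum => z _; rewrite normrM; apply: ler_wpM2l => //; exact: IH.
rewrite -mulr_suml; apply: ler_wpM2r.
  by apply: exprn_ge0; apply: sumr_ge0 => a _; apply: sumr_ge0.
by rewrite [leRHS](bigD1 x) //= lerDl; apply: sumr_ge0 => a _; apply: sumr_ge0.
Qed.

(** By the flow equation and G 0 = 1, the derivatives of G at u = 0 are the powers of M. The Taylor
    series of G summed at u = 1 is therefore the exponential series of M. *)
Lemma rotYE : rotY n t = map_mx (real_complex R) (tens (fun _ : 'I_n => spin_rot t)).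
Proof.
have -> : rotY n t = expmx (map_mx (real_complex R) M).
  congr expmx; apply/matrixP => x y.
  rewrite !mxE !summxE rmorphM rmorph_sum !mulr_sumr; apply: eq_bigr => k _.
  rewrite !mxE -tens_at /=.
  have -> : \prod_l at_qubit k sy_real l (qbit x l) (qbit y l) = tens (at_qubit k sy_real) x y.
    by rewrite mxE.
  rewrite !tens_at; case: ifP => _; last by rewrite rmorph0 !mulr0.
  have ii : 'i * 'i = -1 :> R[i] by rewrite -expr2 sqr_i.
  have h : real_complex R (1 / 2) = 1 / 2 by rewrite rmorphM fmorphV rmorph1 rmorph_nat.
  have n2 : (2 : R[i]) != 0 by rewrite pnatr_eq0.
  (* The arithmetic is done over an abstract field, with i * i = -1 as a hypothesis. *)
  have aux (F : fieldType) (i z : F) : i * i = -1 -> (2 : F) != 0 ->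
    - (i * z) * (i / 2) = z * (1 / 2) /\ - (i * z) * - (i / 2) = z * - (1 / 2).
    move=> hi h2; have E : - (i * z) * (i / 2) = - (i * i) * z / 2 by field.
    by rewrite !mulrN E hi; split; field.
  have [aux1 aux2] := aux _ 'i t%:C ii n2.
  case: (qbit x k); case: (qbit y k); rewrite /sy1 /sy_real ?rmorph0 ?mulr0 //.
    by apply: etrans aux1 _; rewrite -h.
  by apply: etrans aux2 _; rewrite -h -rmorphN.
apply: expmx_real => x y.
have := taylor_cvg (is_derive_mxiter x y) (mxiter_bound x y).
rewrite /g [mxiter M 0]/= mul1mx /G mulr1.
suff -> : tens (fun _ : 'I_n => spin_rot (t * 0)) = 1%:M.
  by under [X in (X @ _)%classic]eq_fun do under eq_bigr do rewrite mulmx1.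
rewrite -tens_id; apply: eq_tens => l a b; rewrite mulr0 /spin_rot mul0r cos0 sin0 oppr0.
by case: a; case: b.
Qed.

End Fixed.
End Rotation.

(** * Spin operators on functions of the Hamming weight *)

Section Spin.
Variable R : realType.

(** Only the two strings that agree with x off bit k contribute to row x. *)
Lemma tens_at_mulmx n (k : 'I_n) (s : bool -> bool -> R) (v : 'cV[R]_(2 ^ n))
    (x : 'I_(2 ^ n)) (y : bool -> 'I_(2 ^ n)) :
  (forall d l, qbit (y d) l = if l == k then d else qbit x l) ->
  (tens (at_qubit k s) *m v) x 0 = \sum_d s (qbit x k) d * v (y d) 0.
Proof.
move=> hy; rewrite mxE (bigID (fun z => y (qbit z k) == z)) /= addrC big1 ?add0r.
  rewrite (reindex_onto y (fun z => qbit z k)) /=; last by move=> z /eqP.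
  apply: eq_big => d; first by rewrite hy eqxx !eqxx.
  move=> _; rewrite tens_at hy eqxx ifT //.
  by apply/forallP => l; apply/implyP => /negbTE hl; rewrite hy hl.
move=> z hz; rewrite tens_at ifF ?mul0r //; apply: contraNF hz => /forallP H.
apply/eqP/bits_inj/ffunP => l; rewrite !ffunE hy.
by have := H l; case: eqP => [->//|_] /eqP.
Qed.

(* one-qubit matrix of a Sz - b Sx *)
Definition spin_ker (a b : R) (u v : bool) : R :=
  match u, v with
  | false, false => a / 2 | true, true => - (a / 2) | _, _ => - (b / 2)
  end.

Variable j : nat.
Local Notation n := (2 * j)%N.
Local Notation N := (2 ^ n)%N.

Definition magn (x : 'I_N) : int := j%:Z - (hweight x)%:Z.

Definition symvec (p : int -> R) : 'cV[R]_N := \col_x p (magn x).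

(* a Jz - b Jx acting on a function of the magnetization m = j - (Hamming weight) *)
Definition spin_op (a b : R) (p : int -> R) (m : int) : R :=
  a * m%:~R * p m
  - b / 2 * ((j%:R + m%:~R) * p (m - 1) + (j%:R - m%:~R) * p (m + 1)).

Lemma hweight_set (x y : 'I_N) (k : 'I_n) d :
  (forall l, qbit y l = if l == k then d else qbit x l) ->
  (hweight y + qbit x k = hweight x + d)%N.
Proof.
move=> hy; rewrite !hweightE (bigD1 k) //= [in RHS](bigD1 k) //= hy eqxx.
rewrite (eq_bigr (fun l => (qbit x l : nat))); first by lia.
by move=> l /negbTE hl; rewrite hy hl.
Qed.

Lemma setbit_surj (x : 'I_N) (k : 'I_n) : exists y : bool -> 'I_N,
  forall d l, qbit (y d) l = if l == k then d else qbit x l.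
Proof.
have [y1 h1] := bits_surj (fun l => if l == k then true else qbit x l).
have [y0 h0] := bits_surj (fun l => if l == k then false else qbit x l).
by exists (fun d => if d then y1 else y0) => -[].
Qed.

Lemma sum_qbit (x : 'I_N) (A B : R) :
  \sum_(k < n) (if qbit x k then A else B)
  = (j%:R - (magn x)%:~R) * A + (j%:R + (magn x)%:~R) * B.
Proof.
rewrite (eq_bigr (fun k => (A - B) *+ qbit x k + B)).
  rewrite big_split /= sumr_const card_ord sumrMnr -hweightE.
  rewrite /magn rmorphB /= -!pmulrn -mulr_natl -[B *+ _]mulr_natl natrM; ring.
by move=> k _; case: (qbit x k); rewrite ?mulr0n ?mulr1n ?add0r ?subrK.
Qed.

(** A string of magnetization m has j + m bits 0, each of whose flips lowers m by 1, and j - m bits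
    1, each of whose flips raises it by 1. *)
Lemma collective_symvec a b p :
  collective n (spin_ker a b) *m symvec p = symvec (spin_op a b p).
Proof.
apply/matrixP => x i; rewrite ord1 {i} mulmx_suml summxE.
rewrite (eq_bigr (fun k => if qbit x k
    then - (a / 2) * p (magn x) - b / 2 * p (magn x + 1)
    else a / 2 * p (magn x) - b / 2 * p (magn x - 1))).
  by rewrite sum_qbit [in RHS]mxE /spin_op; field.
move=> k _; have [y hy] := setbit_surj x k.
rewrite (tens_at_mulmx _ _ hy) big_bool !mxE /=.
have W d := hweight_set (hy d).
have [W1 W0] := (W true, W false).
case E: (qbit x k); rewrite E /= in W1 W0.
  have -> : magn (y true) = magn x by rewrite /magn; lia.
  have -> : magn (y false) = magn x + 1 by rewrite /magn; lia.
  by rewrite /=; ring.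
have -> : magn (y false) = magn x by rewrite /magn; lia.
have -> : magn (y true) = magn x - 1 by rewrite /magn; lia.
by rewrite /=; ring.
Qed.

Lemma collective_z_diag (v : 'cV[R]_N) x :
  (collective n (spin_ker 1 0) *m v) x 0 = (magn x)%:~R * v x 0.
Proof.
rewrite mulmx_suml summxE.
rewrite (eq_bigr (fun k => if qbit x k then - (v x 0 / 2) else v x 0 / 2)).
  by rewrite sum_qbit; field.
move=> k _; have [y hy] := setbit_surj x k.
have yx : y (qbit x k) = x.
  by apply/bits_inj/ffunP => l; rewrite !ffunE hy; case: eqP => [->|].
rewrite (tens_at_mulmx _ _ hy) big_bool.
by case: (qbit x k) yx => -> /=; ring.
Qed.

Lemma sinhalf2 (t : R) : sin t = 2 * sin (t / 2) * cos (t / 2).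
Proof. by rewrite {1}(splitr t) -mulr2n sin_mulr2n; ring. Qed.

Lemma coshalf2 (t : R) : cos t = cos (t / 2) ^+ 2 - sin (t / 2) ^+ 2.
Proof. by rewrite {1}(splitr t) cosD -!expr2. Qed.

(** Heisenberg picture for one qubit: S_z R = R (cos t S_z - sin t S_x). In half angles, each entry
    of the difference is a multiple of c^2 + s^2 - 1. *)
Lemma spin_ker_rot t a b :
  mul2 (spin_ker 1 0) (spin_rot t) a b = mul2 (spin_rot t) (spin_ker (cos t) (sin t)) a b.
Proof.
rewrite !mul2E (sinhalf2 t) (coshalf2 t).
have E : cos (t / 2) ^+ 2 + sin (t / 2) ^+ 2 - 1 = 0 by rewrite cos2Dsin2 subrr.
apply/eqP; rewrite -subr_eq0; apply/eqP.
case: a; case: b; rewrite /=; move: (cos _) (sin _) E => c s E.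
- by transitivity (c / 2 * (c ^+ 2 + s ^+ 2 - 1)); [field | rewrite E mulr0].
- by transitivity (s / 2 * (c ^+ 2 + s ^+ 2 - 1)); [field | rewrite E mulr0].
- by transitivity (s / 2 * (c ^+ 2 + s ^+ 2 - 1)); [field | rewrite E mulr0].
- by transitivity (- c / 2 * (c ^+ 2 + s ^+ 2 - 1)); [field | rewrite E mulr0].
Qed.

Lemma tens_rot_unitary t (u v : 'cV[R]_N) :
  let G := tens (fun _ : 'I_n => spin_rot t) in
  (G *m u)^T *m (G *m v) = u^T *m v.
Proof.
move=> G; rewrite trmx_mul -mulmxA [G^T *m _]mulmxA.
suff -> : G^T *m G = 1%:M by rewrite mul1mx.
have -> : G^T = tens (fun (_ : 'I_n) a b => spin_rot t b a).
  by apply/matrixP => x y; rewrite !mxE.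
rewrite tens_mul -tens_id; apply: eq_tens => l a b; rewrite mul2E /id2.
by case: a; case: b; rewrite /= -?[RHS](cos2Dsin2 (t / 2)); ring.
Qed.

(** The left side is the inner product of G p with Jz^k G p. Moving G to the left past each Jz turns
    Jz into cos t Jz - sin t Jx, after which G cancels because it is orthogonal. *)
Lemma amplitude_moment t (p : int -> R) k :
  let G := tens (fun _ : 'I_n => spin_rot t) in
  \sum_x (magn x)%:~R ^+ k * ((G *m symvec p) x 0) ^+ 2
  = \sum_x p (magn x) * iter k (spin_op (cos t) (sin t)) p (magn x).
Proof.
move=> G.
have DG i : iter i (mulmx (collective n (spin_ker 1 0))) (G *m symvec p)
    = G *m symvec (iter i (spin_op (cos t) (sin t)) p).
  elim: i => // i IH; rewrite !iterS IH mulmxA.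
  by rewrite (collective_tens _ (spin_ker_rot t)) -mulmxA collective_symvec.
have D i x : iter i (mulmx (collective n (spin_ker 1 0))) (G *m symvec p) x 0
    = (magn x)%:~R ^+ i * (G *m symvec p) x 0.
  elim: i => [|i IH]; first by rewrite expr0 mul1r.
  by rewrite iterS collective_z_diag IH exprS mulrA.
have := tens_rot_unitary t (symvec p) (symvec (iter k (spin_op (cos t) (sin t)) p)).
rewrite /= -/G -DG => /matrixP/(_ 0 0); rewrite !mxE => H.
rewrite [RHS](_ : _ = \sum_x (symvec p)^T 0 x * symvec (iter k (spin_op (cos t) (sin t)) p) x 0).
  by rewrite -H; apply: eq_bigr => x _; rewrite D [in RHS]mxE; ring.
by apply: eq_bigr => x _; rewrite !mxE.
Qed.

End Spin.

(** * Measurement outcomes of the rotated Dicke state *)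

Section Outcomes.
Variable R : realType.
Variable j : nat.
Local Notation n := (2 * j)%N.
Local Notation N := (2 ^ n)%N.
Implicit Types (m : int) (x : 'I_N).

Definition dicke_coef (m : int) : R := (Num.sqrt ('C(n, `|j%:Z - m|%N))%:R)^-1.

Definition delta (m m' : int) : R := (m' == m)%:R.

(** Amplitudes of the rotated Dicke state; they are real because -i S_y is a real matrix. *)
Definition amp (m : int) (x : 'I_N) : R :=
  (tens (fun _ : 'I_n => spin_rot (theta R j m)) *m
     symvec j (fun m' => dicke_coef m * delta m m')) x 0.

Lemma hweight_magn m x : `|m| <= j%:Z -> (hweight x == `|j%:Z - m|%N) = (magn x == m).
Proof. by move=> hm; rewrite /magn; lia. Qed.

Lemma rotatedE m : `|m| <= j%:Z ->
  rotated R j m = map_mx (real_complex R) (\col_x amp m x).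
Proof.
move=> hm; rewrite /rotated rotYE.
have -> : dicke R j m = map_mx (real_complex R) (symvec j (fun m' => dicke_coef m * delta m m')).
  apply/matrixP => x i; rewrite !mxE hweight_magn // /delta.
  by case: eqP => _; rewrite ?mulr1 ?mulr0.
rewrite -map_mxM; congr map_mx; apply/matrixP => x i; rewrite [RHS]mxE ord1.
by [].
Qed.

Lemma Jz_diag x : Jz R n x x = (magn x)%:~R.
Proof.
rewrite /Jz summxE.
rewrite (eq_bigr (fun k => real_complex R (if qbit x k then - (1 / 2) else 1 / 2))).
  by rewrite -rmorph_sum sum_qbit -[RHS](rmorph_int (real_complex R)); congr (_%:C); field.
move=> k _; rewrite mxE ifT; last by apply/forallP => l; rewrite eqxx implybT.
have h : real_complex R (1 / 2) = 1 / 2 by rewrite rmorphM fmorphV rmorph1 rmorph_nat.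
by rewrite /sz1; case: (qbit x k); rewrite -h -?rmorphN.
Qed.

Lemma probJzE m m' : `|m| <= j%:Z ->
  probJz m' (rotated R j m) = \sum_(x | magn x == m') amp m x ^+ 2.
Proof.
move=> hm; rewrite /probJz [RHS]big_mkcond; apply: eq_bigr => x _.
rewrite /absq /projJz mxE Jz_diag eqr_int rotatedE // !mxE.
by case: eqP => _ /=; rewrite expr0n ?addr0 ?expr0n ?addr0.
Qed.

Lemma magn_range x : exists i : 'I_n.+1, magn x = mval i.
Proof.
have h := hweight_le x.
have hi : (n - hweight x < n.+1)%N by rewrite ltnS leq_subr.
by exists (Ordinal hi); rewrite /magn /mval /=; lia.
Qed.

Lemma mval_inj : injective (@mval j).
Proof. by move=> i i'; rewrite /mval => /addIr []; exact: val_inj. Qed.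

Lemma sum_outcomes m (h : int -> R) : `|m| <= j%:Z ->
  \sum_(i < n.+1) h (mval i) * probJz (mval i) (rotated R j m)
  = \sum_x h (magn x) * amp m x ^+ 2.
Proof.
move=> hm; under eq_bigr => i _ do rewrite probJzE // mulr_sumr big_mkcond.
rewrite exchange_big; apply: eq_bigr => x _ /=.
have [i0 hi0] := magn_range x.
rewrite (bigD1 i0) //= hi0 eqxx big1 ?addr0 // => i hi.
by rewrite ifF //; apply: contraNF hi => /eqP /mval_inj ->.
Qed.

Lemma card_magn m : `|m| <= j%:Z ->
  #|[set x : 'I_N | magn x == m]| = 'C(n, `|j%:Z - m|%N).
Proof.
move=> hm; rewrite -card_hweight; apply: eq_card => x.
by rewrite !inE hweight_magn.
Qed.

Lemma bin_gt0_magn m : `|m| <= j%:Z -> (0 < 'C(n, `|j%:Z - m|%N))%N.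
Proof. by move=> hm; rewrite bin_gt0; lia. Qed.

Lemma iter_spin_op_scale (a b c : R) p k m :
  iter k (spin_op j a b) (fun m' => c * p m') m = c * iter k (spin_op j a b) p m.
Proof.
have -> : iter k (spin_op j a b) (fun m' => c * p m')
    = (fun m' => c * iter k (spin_op j a b) p m').
  by elim: k => //= k ->; apply/funext => m'; rewrite /spin_op; ring.
by [].
Qed.

(** In [amplitude_moment] only the strings of magnetization m survive on the right, and their number
    cancels the squared normalization of the Dicke state. *)
Lemma outcome_moment m k : `|m| <= j%:Z ->
  \sum_(i < n.+1) (mval i)%:~R ^+ k * probJz (mval i) (rotated R j m)
  = iter k (spin_op j (cos (theta R j m)) (sin (theta R j m))) (delta m) m.
Proof.
move=> hm; rewrite (sum_outcomes (fun m' => m'%:~R ^+ k)) // /amp amplitude_moment.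
under eq_bigr => x _ do rewrite iter_spin_op_scale /delta.
set q := iter _ _ _.
rewrite (bigID (fun x => magn x == m)) /= [X in _ + X]big1 ?addr0; last first.
  by move=> x /negbTE ->; rewrite mulr0 mul0r.
rewrite (eq_bigr (fun _ => dicke_coef m ^+ 2 * q m)); last first.
  by move=> x /eqP ->; rewrite eqxx mulr1 mulrA expr2.
have -> : \sum_(x : 'I_N | magn x == m) dicke_coef m ^+ 2 * q m
   = ('C(n, `|j%:Z - m|%N))%:R * (dicke_coef m ^+ 2 * q m).
  rewrite -card_magn // -sum1dep_card.
  by rewrite natr_sum mulr_suml; apply: eq_bigr => x _; rewrite mul1r.
have h0 := bin_gt0_magn hm.
rewrite /dicke_coef exprVn sqr_sqrtr ?ler0n // mulrA divff ?mul1r //.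
by rewrite pnatr_eq0 -lt0n.
Qed.

Lemma probJz_ge0 m m' : 0 <= probJz m' (rotated R j m).
Proof.
by apply: sumr_ge0 => x _; rewrite /absq addr_ge0 ?sqr_ge0.
Qed.

Lemma probJz_sum1 m : `|m| <= j%:Z ->
  \sum_(i < n.+1) probJz (mval i) (rotated R j m) = 1.
Proof.
move=> hm; have H := outcome_moment 0 hm; rewrite /= /delta eqxx in H; rewrite -[RHS]H.
by apply: eq_bigr => i _; rewrite expr0 mul1r.
Qed.

End Outcomes.

(** * The first four moments of the outcome *)

Section Moments.
Variable R : realType.

(* spin_op with the magnetization m + i - 4 indexed by i : nat: the offset 4 suffices
   for four iterations at m, and makes the moments computable by simplification. *)
Definition offset_op (J M a b : R) (p : nat -> R) (i : nat) : R :=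
  a * (M + i%:R - 4) * p i
  - b / 2 * ((J + M + i%:R - 4) * p i.-1 + (J - M - i%:R + 4) * p i.+1).

(** Each iteration reaches one index down, so k <= i keeps [i.-1] away from the truncation at 0. *)
Lemma iter_offset_op j m (a b : R) k i : (k <= i)%N ->
  iter k (spin_op j a b) (delta R m) (m + i%:Z - 4)
  = iter k (offset_op j%:R m%:~R a b) (fun i => (i == 4%N)%:R) i.
Proof.
elim: k i => [|k IH] i ki.
  by rewrite /= /delta; congr (nat_of_bool _)%:R; apply/eqP/eqP; lia.
rewrite !iterS /spin_op /offset_op -!IH; [|lia..].
have -> : m + i%:Z - 4 - 1 = m + (i.-1)%:Z - 4 by lia.
have -> : m + i%:Z - 4 + 1 = m + (i.+1)%:Z - 4 by lia.
by rewrite !rmorphB !rmorphD /= -!pmulrn; ring.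
Qed.

Lemma iter_offset_op0 j m (a b : R) k : (k <= 4)%N ->
  iter k (spin_op j a b) (delta R m) m
  = iter k (offset_op j%:R m%:~R a b) (fun i => (i == 4%N)%:R) 4.
Proof.
by move=> k4; rewrite -iter_offset_op //; congr (iter _ _ _ _); lia.
Qed.

Section Values.
Variables (j : nat) (m : int) (a b : R).
Let J : R := j%:R.
Let M : R := m%:~R.
Let A : R := J * (J + 1) - M ^+ 2.
Local Notation mom k := (iter k (spin_op j a b) (delta R m) m).

Lemma spin_moment1 : mom 1 = a * M.
Proof. by rewrite iter_offset_op0 //= /offset_op /=; ring. Qed.

Lemma spin_moment2 : mom 2 = a ^+ 2 * M ^+ 2 + b ^+ 2 * A / 2.
Proof. by rewrite iter_offset_op0 //= /offset_op /= /A; field. Qed.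

Lemma spin_moment3 : mom 3 = a ^+ 3 * M ^+ 3 + a * b ^+ 2 * M * (3 * A - 1) / 2.
Proof. by rewrite iter_offset_op0 //= /offset_op /= /A; field. Qed.

Lemma spin_moment4 : mom 4 = a ^+ 4 * M ^+ 4
  + a ^+ 2 * b ^+ 2 * (3 * M ^+ 2 * A + A / 2 - 2 * M ^+ 2)
  + b ^+ 4 * (3 * A ^+ 2 / 8 - A / 4 + 3 * M ^+ 2 / 8).
Proof. by rewrite iter_offset_op0 //= /offset_op /= /A; field. Qed.
End Values.
End Moments.

(** * Majorants of the cube root *)

Section CubeRoot.
Variable R : realType.

(* With z^3 = |x|, the majorant of cbrt_quartic minus z is (z - 1)^2 / 3 times cbrt_gap_pos z
   for 0 <= x and cbrt_gap_neg z / 3 for x <= 0.  On each piece below the gap has nonnegative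
   coefficients in the Bernstein basis of the interval, which is what lra finds. *)
Definition cbrt_gap_pos (z : R) : R := z + 2 + (z ^+ 2 + z + 1) ^+ 2 *
    (- (1 / 5) - 17 / 100 * (z ^+ 3 - 1) + 17 / 100 * (z ^+ 3 - 1) ^+ 2).

Lemma cbrt_gap_pos_ge0_0 (z : R) : 0 <= z -> z <= 3 / 4 -> 0 <= cbrt_gap_pos z.
Proof.
rewrite /cbrt_gap_pos; move=> h1 h2.
have B i k : 0 <= (z) ^+ i * (3 / 4 - z) ^+ k.
  by rewrite mulr_ge0 ?exprn_ge0 ?subr_ge0.
move: (B 0 10) (B 1 9) (B 2 8) (B 3 7) (B 4 6) (B 5 5) (B 6 4) (B 7 3) (B 8 2) (B 9 1) (B 10 0); lra.
Qed.

Lemma cbrt_gap_pos_ge0_1 (z : R) : 3 / 4 <= z -> z <= 9 / 8 -> 0 <= cbrt_gap_pos z.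
Proof.
rewrite /cbrt_gap_pos; move=> h1 h2.
have B i k : 0 <= (z - 3 / 4) ^+ i * (9 / 8 - z) ^+ k.
  by rewrite mulr_ge0 ?exprn_ge0 ?subr_ge0.
move: (B 0 10) (B 1 9) (B 2 8) (B 3 7) (B 4 6) (B 5 5) (B 6 4) (B 7 3) (B 8 2) (B 9 1) (B 10 0); lra.
Qed.

Lemma cbrt_gap_pos_ge0_2 (z : R) : 9 / 8 <= z -> z <= 21 / 16 -> 0 <= cbrt_gap_pos z.
Proof.
rewrite /cbrt_gap_pos; move=> h1 h2.
have B i k : 0 <= (z - 9 / 8) ^+ i * (21 / 16 - z) ^+ k.
  by rewrite mulr_ge0 ?exprn_ge0 ?subr_ge0.
move: (B 0 10) (B 1 9) (B 2 8) (B 3 7) (B 4 6) (B 5 5) (B 6 4) (B 7 3) (B 8 2) (B 9 1) (B 10 0); lra.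
Qed.

Lemma cbrt_gap_pos_ge0_3 (z : R) : 21 / 16 <= z -> z <= 3 / 2 -> 0 <= cbrt_gap_pos z.
Proof.
rewrite /cbrt_gap_pos; move=> h1 h2.
have B i k : 0 <= (z - 21 / 16) ^+ i * (3 / 2 - z) ^+ k.
  by rewrite mulr_ge0 ?exprn_ge0 ?subr_ge0.
move: (B 0 10) (B 1 9) (B 2 8) (B 3 7) (B 4 6) (B 5 5) (B 6 4) (B 7 3) (B 8 2) (B 9 1) (B 10 0); lra.
Qed.

Lemma cbrt_gap_pos_ge0_4 (z : R) : 3 / 2 <= z -> 0 <= cbrt_gap_pos z.
Proof.
rewrite /cbrt_gap_pos; move=> h1.
(* On this unbounded piece the expansion in powers of z - 3/2 has nonnegative coefficients. *)
have B i : 0 <= (z - 3 / 2) ^+ i by rewrite exprn_ge0 ?subr_ge0.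
move: (B 1) (B 2) (B 3) (B 4) (B 5) (B 6) (B 7) (B 8) (B 9) (B 10); lra.
Qed.

Lemma cbrt_gap_pos_ge0 (z : R) : 0 <= z -> 0 <= cbrt_gap_pos z.
Proof.
move=> h.
have [h0|/ltW h0] := lerP z (3 / 4); first exact: cbrt_gap_pos_ge0_0 h h0.
have [h1|/ltW h1] := lerP z (9 / 8); first exact: cbrt_gap_pos_ge0_1 h0 h1.
have [h2|/ltW h2] := lerP z (21 / 16); first exact: cbrt_gap_pos_ge0_2 h1 h2.
have [h3|/ltW h3] := lerP z (3 / 2); first exact: cbrt_gap_pos_ge0_3 h2 h3.
exact: cbrt_gap_pos_ge0_4 h3.
Qed.

Definition cbrt_gap_neg (z : R) : R := 3 - 3 * z - (1 + z ^+ 3) - 1 / 5 * (1 + z ^+ 3) ^+ 2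
    + 17 / 100 * (1 + z ^+ 3) ^+ 3 + 17 / 100 * (1 + z ^+ 3) ^+ 4.

Lemma cbrt_gap_neg_ge0_0 (z : R) : 0 <= z -> z <= 1 / 2 -> 0 <= cbrt_gap_neg z.
Proof.
rewrite /cbrt_gap_neg; move=> h1 h2.
have B i k : 0 <= (z) ^+ i * (1 / 2 - z) ^+ k.
  by rewrite mulr_ge0 ?exprn_ge0 ?subr_ge0.
move: (B 0 12) (B 1 11) (B 2 10) (B 3 9) (B 4 8) (B 5 7) (B 6 6)
  (B 7 5) (B 8 4) (B 9 3) (B 10 2) (B 11 1) (B 12 0); lra.
Qed.

Lemma cbrt_gap_neg_ge0_1 (z : R) : 1 / 2 <= z -> z <= 1 -> 0 <= cbrt_gap_neg z.
Proof.
rewrite /cbrt_gap_neg; move=> h1 h2.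
have B i k : 0 <= (z - 1 / 2) ^+ i * (1 - z) ^+ k.
  by rewrite mulr_ge0 ?exprn_ge0 ?subr_ge0.
move: (B 0 12) (B 1 11) (B 2 10) (B 3 9) (B 4 8) (B 5 7) (B 6 6)
  (B 7 5) (B 8 4) (B 9 3) (B 10 2) (B 11 1) (B 12 0); lra.
Qed.

Lemma cbrt_gap_neg_ge0_2 (z : R) : 1 <= z -> 0 <= cbrt_gap_neg z.
Proof.
rewrite /cbrt_gap_neg; move=> h1.
have B i : 0 <= (z - 1) ^+ i by rewrite exprn_ge0 ?subr_ge0.
move: (B 1) (B 2) (B 3) (B 4) (B 5) (B 6) (B 7) (B 8) (B 9) (B 10) (B 11) (B 12); lra.
Qed.

Lemma cbrt_gap_neg_ge0 (z : R) : 0 <= z -> 0 <= cbrt_gap_neg z.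
Proof.
move=> h.
have [h0|/ltW h0] := lerP z (1 / 2); first exact: cbrt_gap_neg_ge0_0 h h0.
have [h1|/ltW h1] := lerP z (1); first exact: cbrt_gap_neg_ge0_1 h0 h1.
exact: cbrt_gap_neg_ge0_2 h1.
Qed.

Definition cbrt (y : R) : R := y `^ 3^-1.

Lemma cbrt_ge0 y : 0 <= cbrt y.
Proof. exact: powR_ge0. Qed.

Lemma cbrtK y : 0 <= y -> cbrt y ^+ 3 = y.
Proof.
move=> y0; rewrite -powR_mulrn ?cbrt_ge0 // /cbrt -powRrM mulVf ?powRr1 //.
Qed.

Lemma cbrtM x y : 0 <= x -> 0 <= y -> cbrt (x * y) = cbrt x * cbrt y.
Proof. exact: powRM. Qed.

Lemma cbrt0 : cbrt 0 = 0.
Proof. by rewrite /cbrt powR0 // invr_eq0 pnatr_eq0. Qed.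

Lemma le_cbrt x y : 0 <= x -> x <= y -> cbrt x <= cbrt y.
Proof.
move=> x0 xy; apply: ge0_ler_powR => //; rewrite ?nnegrE ?invr_ge0 //.
exact: le_trans xy.
Qed.

(* Coefficients chosen so that -(1/5) T2 - (17/100) T3 + (17/100) T4 < 0 at the limiting central
   moments T2 = 1/2, T3 = 0, T4 = 3/8 + 1/(2 m^2) for every |m| >= 2. *)
Lemma cbrt_quartic (x t : R) : t = x - 1 ->
  cbrt `|x| <= 1 + (t - 1 / 5 * t ^+ 2 - 17 / 100 * t ^+ 3 + 17 / 100 * t ^+ 4) / 3.
Proof.
move=> ht; have z0 := cbrt_ge0 `|x|; have := cbrtK (normr_ge0 x).
move: (cbrt _) z0 => z z0 hz; rewrite -subr_ge0.
have [x0|x0] := lerP 0 x; rewrite ?(ger0_norm x0) ?(ltr0_norm x0) in hz.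
  rewrite [leRHS](_ : _ = (z - 1) ^+ 2 * cbrt_gap_pos z / 3).
    by rewrite divr_ge0 // mulr_ge0 ?sqr_ge0 ?cbrt_gap_pos_ge0.
  by rewrite ht -hz /cbrt_gap_pos; field.
rewrite [leRHS](_ : _ = cbrt_gap_neg z / 3).
  by rewrite divr_ge0 // cbrt_gap_neg_ge0.
have -> : t = - (1 + z ^+ 3) by rewrite ht hz opprD opprK addrC.
by rewrite /cbrt_gap_neg; field.
Qed.

Lemma cbrt_le_tangent (y : R) : 0 <= y -> cbrt y <= (y + 2) / 3.
Proof.
move=> y0; rewrite -{2}(cbrtK y0); have := cbrt_ge0 y; move: (cbrt y) => z z0.
rewrite -subr_ge0 [leRHS](_ : _ = (z - 1) ^+ 2 * (z + 2) / 3); last by field.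
by rewrite divr_ge0 // mulr_ge0 ?sqr_ge0 // addr_ge0.
Qed.

(* For |m| = 1 the fourth moment is 7/8, too large for cbrt_quartic; but then m'/m is an
   integer, and a majorant is only needed at integers. *)
Lemma cbrt_quartic_int (k : int) (t : R) : t = k%:~R - 1 ->
  cbrt `|k%:~R| <= 1 + 2 / 3 * t - 5 / 9 * t ^+ 2 + 2 / 9 * t ^+ 4.
Proof.
(* The quartic has no cubic term and is fixed by four values: 0 at k = 0, and the tangent bound (|k|
   + 2) / 3 at k = -1, 1, 2. These k supply the linear factors in the factorizations below. *)
move=> ht; have [k0|k0] := eqVneq k 0.
  by rewrite ht k0 normr0 cbrt0; lra.
apply: le_trans (cbrt_le_tangent (normr_ge0 _)) _.
have [kpos|kneg] := lerP 0 k.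
  rewrite ger0_norm ?ler0z //.
  have [k1|k1] := eqVneq k 1; first by rewrite ht k1; lra.
  have k2 : 1 <= t by rewrite ht lerBrDr (_ : 1 + 1 = 2%:~R) // ler_int; lia.
  have -> : k%:~R = t + 1 :> R by rewrite ht subrK.
  rewrite -subr_ge0 [leRHS](_ : _ = t * (t - 1) * (2 * t ^+ 2 + 2 * t - 3) / 9); last by field.
  by rewrite divr_ge0 // !mulr_ge0 //; nra.
have k2 : t <= -2 by rewrite ht lerBlDr (_ : -2 + 1 = (-1)%:~R) // ?ler_int; [lia|lra].
rewrite ltr0_norm ?ltrz0 //.
have -> : k%:~R = t + 1 :> R by rewrite ht subrK.
rewrite -subr_ge0 [leRHS](_ : _ = (- t - 2) * (2 * (- t) ^+ 3 + 4 * t ^+ 2 - 3 * t - 3) / 9); last first.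
  by field.
by rewrite divr_ge0 // mulr_ge0 //; nra.
Qed.

End CubeRoot.

(** * Contraction *)

Section Contraction.
Variable R : realType.

(* Moments of m'/m of orders 2, 3, 4, with a = cos theta, e = 1/j, s = (m/j)^2, u = 1/m^2. *)
Definition rel2 (a e s : R) : R := a ^+ 2 + (1 + e - s) / 2.
Definition rel3 (a e s : R) : R :=
  a ^+ 3 + a * (3 * (1 + e - s) - e ^+ 2) / 2.
Definition rel4 (a e s u : R) : R :=
  a ^+ 4 + a ^+ 2 * (3 * (1 + e - s) + (1 + e - s) * u / 2 - 2 * e ^+ 2)
  + 3 * (1 + e - s) ^+ 2 / 8 - (1 + e - s) * e ^+ 2 / 4 + 3 * s * e ^+ 2 / 8.

(** The central moments of m'/m about 1 are compared with 1/2, 0 and 3/8 + u/2 up to O(e), where s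
    <= e encodes m^2 <= j. Each bound goes in the direction required by the sign of the matching
    coefficient of the majorants. *)
Lemma central_bounds (a e s u : R) : a ^+ 2 = 1 - s -> 0 <= a -> 0 <= s -> s <= e ->
  e <= 1 -> 0 <= u -> u <= 1 ->
  [/\ a <= 1, 1 / 2 - 2 * e <= rel2 a e s - 2 * a + 1,
    - (11 * e) <= rel3 a e s - 3 * rel2 a e s + 3 * a - 1 &
    rel4 a e s u - 4 * rel3 a e s + 6 * rel2 a e s - 4 * a + 1 <= 3 / 8 + u / 2 + 45 * e].
Proof.
move=> ha a0 s0 se e1 u0 u1.
have a1 : a <= 1 by rewrite -(expr_le1 (n := 2)) // ha; lra.
have as1 : 1 - s <= a by rewrite -ha expr2; have := ler_wpM2l a0 a1; rewrite mulr1.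
have e0 : 0 <= e by exact: le_trans se.
have ee : e ^+ 2 <= e by rewrite expr2; have := ler_wpM2l e0 e1; rewrite mulr1.
have ee0 := sqr_ge0 e.
have E3 : rel3 a e s = a * (5 / 2 + 3 / 2 * e - 5 / 2 * s - e ^+ 2 / 2).
  by rewrite /rel3 exprS ha; field.
have h3 : 5 / 2 - 6 * e <= rel3 a e s.
  rewrite E3.
  have h : 5 / 2 - 3 / 2 * e <= 5 / 2 + 3 / 2 * e - 5 / 2 * s - e ^+ 2 / 2 by lra.
  have h' : 0 <= 5 / 2 - 3 / 2 * e by lra.
  apply: le_trans (ler_pM _ h' as1 h); last by lra.
  suff : 0 <= (e - s) * (5 / 2 - 3 / 2 * e) + 3 / 2 * e ^+ 2 by lra.
  by rewrite addr_ge0 ?mulr_ge0 ?subr_ge0 //; lra.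
have h2 : rel2 a e s <= 3 / 2 + e / 2 by rewrite /rel2 ha; lra.
split => //.
- by rewrite /rel2 ha; lra.
- by lra.
suff h4 : rel4 a e s u <= 35 / 8 + u / 2 + 10 * e by lra.
rewrite /rel4 (_ : a ^+ 4 = (a ^+ 2) ^+ 2); last by rewrite -exprM.
rewrite ha.
set al := 1 + e - s.
have al0 : 0 <= al by rewrite /al; lra.
have ale : al <= 1 + e by rewrite /al; lra.
have h5 : (1 - s) ^+ 2 <= 1.
  have : 0 <= s * (2 - s) by rewrite mulr_ge0 //; lra.
  by lra.
have h6 : (1 - s) * (3 * al + al * u / 2 - 2 * e ^+ 2)
   <= 3 * (1 + e) + (1 + e) * u / 2.
  have p1 : 0 <= al * u by rewrite mulr_ge0.
  have p2 : al * u <= (1 + e) * u by apply: ler_wpM2r.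
  have p3 : 0 <= s * al by rewrite mulr_ge0.
  have p4 : 0 <= s * (al * u) by rewrite mulr_ge0.
  have p5 : 0 <= (1 - s) * e ^+ 2 by rewrite mulr_ge0 //; lra.
  by lra.
have h7 : al ^+ 2 <= 1 + 3 * e.
  by rewrite expr2; apply: le_trans (ler_pM al0 al0 ale ale) _; lra.
have h8 : 0 <= al * e ^+ 2 by rewrite mulr_ge0.
have h9 : s * e ^+ 2 <= e.
  have : s * e ^+ 2 <= 1 * e by apply: ler_pM => //; lra.
  by rewrite mul1r.
have h10 : e * u <= e by have := ler_wpM2l e0 u1; rewrite mulr1.
by lra.
Qed.

Lemma sin_theta j m : (0 < j)%N -> `|m| <= j%:Z ->
  sin (theta R j m) = m%:~R / j%:R.
Proof.
move=> j0 hm; apply: asinK.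
have j0' : 0 < j%:R :> R by rewrite ltr0n.
rewrite in_itv /= ler_pdivlMr // ler_pdivrMr // mulN1r mul1r -ler_norml.
by rewrite -intr_norm pmulrn ler_int.
Qed.

Lemma cos_theta_ge0 j m : (0 < j)%N -> `|m| <= j%:Z -> 0 <= cos (theta R j m).
Proof.
move=> j0 hm; rewrite cos_asin ?sqrtr_ge0 //.
have j0' : 0 < j%:R :> R by rewrite ltr0n.
rewrite ler_pdivlMr // ler_pdivrMr // mulN1r mul1r -ler_norml.
by rewrite -intr_norm pmulrn ler_int.
Qed.

Lemma sqr_cos_theta j m : (0 < j)%N -> `|m| <= j%:Z ->
  cos (theta R j m) ^+ 2 = 1 - (m%:~R / j%:R) ^+ 2.
Proof. by move=> j0 hm; rewrite cos2sin2 sin_theta. Qed.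

Local Notation P j m i := (probJz (mval (j := j) i) (rotated R j m)).

(** Rewritten in powers of m', the quartic involves only the raw moments of orders 0 to 4, which are
    known exactly; sin theta = m/j gives the relative form. *)
Lemma expect_quartic j m (c0 c1 c2 c3 c4 : R) : (0 < j)%N -> `|m| <= j%:Z -> m != 0 ->
  let a := cos (theta R j m) in let e := j%:R^-1 in
  let s := (m%:~R / j%:R) ^+ 2 in let u := m%:~R ^- 2 in
  let T2 := rel2 a e s - 2 * a + 1 in
  let T3 := rel3 a e s - 3 * rel2 a e s + 3 * a - 1 in
  let T4 := rel4 a e s u - 4 * rel3 a e s + 6 * rel2 a e s - 4 * a + 1 in
  \sum_(i < (2 * j).+1) (c0 + c1 * ((mval i)%:~R / m%:~R - 1)
     + c2 * ((mval i)%:~R / m%:~R - 1) ^+ 2 + c3 * ((mval i)%:~R / m%:~R - 1) ^+ 3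
     + c4 * ((mval i)%:~R / m%:~R - 1) ^+ 4) * P j m i
  = c0 + c1 * (a - 1) + c2 * T2 + c3 * T3 + c4 * T4.
Proof.
move=> j0 hm m0 a e s u T2 T3 T4.
have J0 : j%:R != 0 :> R by rewrite pnatr_eq0 -lt0n.
have M0 : m%:~R != 0 :> R by rewrite intr_eq0.
set M : R := m%:~R.
transitivity (\sum_(i < (2 * j).+1)
  ((c0 - c1 + c2 - c3 + c4) * P j m i
  + (c1 - 2 * c2 + 3 * c3 - 4 * c4) / M * ((mval i)%:~R ^+ 1 * P j m i)
  + (c2 - 3 * c3 + 6 * c4) / M ^+ 2 * ((mval i)%:~R ^+ 2 * P j m i)
  + (c3 - 4 * c4) / M ^+ 3 * ((mval i)%:~R ^+ 3 * P j m i)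
  + c4 / M ^+ 4 * ((mval i)%:~R ^+ 4 * P j m i))).
  by apply: eq_bigr => i _; field.
rewrite !big_split /= -!mulr_sumr !outcome_moment // probJz_sum1 //.
rewrite spin_moment1 spin_moment2 spin_moment3 spin_moment4 -/a sin_theta // -/M.
rewrite /T2 /T3 /T4 /rel2 /rel3 /rel4 /s /e /u -/M.
by field; rewrite J0 M0.
Qed.

End Contraction.

(** * One-step drift and the Lyapunov criterion *)

Section Drift.
Variable R : realType.
Local Notation P j m i := (probJz (mval (j := j) i) (rotated R j m)).

(** After division by the cube root of |m|, the majorant for |m| >= 2 has mean at most 1 - 1/30 +
    17/600 = 1 - 1/200 up to an error of about 3.31 / j. The condition j >= 64^2 keeps that error
    below 1/1000, whence 249/250. For |m| = 1 the limiting value is 11/12. *)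
Lemma cbrt_contraction j (m : int) : (0 < j)%N -> j%:R^-1 <= 1 / 64 / 64 :> R ->
  m != 0 -> m%:~R ^+ 2 <= j%:R :> R ->
  \sum_(i < (2 * j).+1) cbrt `|(mval i)%:~R| * P j m i <= 249 / 250 * cbrt (`|m%:~R| : R).
Proof.
move=> j0 he m0 mj.
have J0 : 0 < j%:R :> R by rewrite ltr0n.
have M0 : m%:~R != 0 :> R by rewrite intr_eq0.
have m1 : 1 <= `|m%:~R : R| by rewrite -intr_norm (_ : 1 = 1%:~R) // ler_int; clear -m0; lia.
have hm : `|m| <= j%:Z.
  rewrite -(ler_int R) intr_norm -pmulrn; apply: le_trans mj.
  by rewrite -real_normK ?num_real // expr2 ler_peMl // normr_ge0.
set e : R := j%:R^-1 in he; set s : R := (m%:~R / j%:R) ^+ 2; set u : R := m%:~R ^- 2.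
have e0 : 0 <= e by rewrite invr_ge0 ltW.
have se : s <= e.
  rewrite /s expr_div_n ler_pdivrMr ?exprn_gt0 // /e expr2 mulrA mulVf ?mul1r //.
  by rewrite gt_eqF.
have u0 : 0 <= u by rewrite invr_ge0 sqr_ge0.
have M2 : 1 <= (m%:~R : R) ^+ 2.
  by rewrite -real_normK ?num_real // exprn_ege1.
have u1 : u <= 1 by rewrite invf_le1 // (lt_le_trans ltr01).
have e1 : e <= 1 by lra.
have [a1 T2 T3 T4] := @central_bounds R _ e s u (sqr_cos_theta R j0 hm)
  (cos_theta_ge0 R j0 hm) (sqr_ge0 _) se e1 u0 u1.
have scale i : cbrt `|(mval (j := j) i)%:~R : R|
    = cbrt `|m%:~R| * cbrt `|(mval i)%:~R / m%:~R|.
  by rewrite -cbrtM // -normrM mulrCA divff // mulr1.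
under eq_bigr => i _ do rewrite scale -mulrA.
rewrite -mulr_sumr mulrC; apply: ler_wpM2r; first exact: cbrt_ge0.
have [mle1|mge2] := lerP `|m| 1.
  have hm1 : m = 1 \/ m = -1 by clear -m0 mle1; lia.
  pose t i : R := (mval (j := j) i)%:~R / m%:~R - 1.
  apply: (@le_trans _ _ (\sum_(i < (2 * j).+1) (1 + 2 / 3 * t i
     + (- (5 / 9)) * t i ^+ 2 + 0 * t i ^+ 3 + 2 / 9 * t i ^+ 4) * P j m i)).
    apply: ler_sum => i _; apply: ler_wpM2r; first exact: probJz_ge0.
    (* Since m is 1 or -1, dividing by m is multiplying by m, and the ratio is an integer. *)
    have E : (mval i)%:~R / m%:~R = (mval i * m)%:~R :> R.
      by case: hm1 => ->; rewrite intrM ?divr1 ?mulr1 // intrN invrN1.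
    rewrite E; apply: le_trans (@cbrt_quartic_int R _ (t i) _) _; last by lra.
    by rewrite /t E.
  rewrite expect_quartic // -/e -/s -/u; lra.
have u4 : u <= 1 / 4.
  rewrite /u -[1 / 4]invrK lef_pV2 ?posrE ?(lt_le_trans ltr01) //; last by lra.
  rewrite invf_div divr1 -real_normK ?num_real // -intr_norm.
  have : 2 <= `|m|%:~R :> R by rewrite (_ : 2 = 2%:~R) // ler_int; clear -mge2; lia.
  by move: (_%:~R) => y y2; nra.
pose t i : R := (mval (j := j) i)%:~R / m%:~R - 1.
apply: (@le_trans _ _ (\sum_(i < (2 * j).+1) (1 + 1 / 3 * t i
   + (- (1 / 15)) * t i ^+ 2 + (- (17 / 300)) * t i ^+ 3 + 17 / 300 * t i ^+ 4) * P j m i)).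
  apply: ler_sum => i _; apply: ler_wpM2r; first exact: probJz_ge0.
  by apply: le_trans (@cbrt_quartic R _ (t i) _) _ => //; lra.
by rewrite expect_quartic // -/e -/s -/u; lra.
Qed.

(** From m = j the angle has sine 1 and cosine 0, so m' has second moment j/2. With z^3 = |m'| /
    sqrt j, the bound z <= (z^6 + 5) / 6 has mean (1/2 + 5) / 6 = 11/12. *)
Lemma cbrt_initial j : (0 < j)%N ->
  \sum_(i < (2 * j).+1) cbrt `|(mval i)%:~R| * P j j%:Z i
  <= 11 / 12 * cbrt (Num.sqrt (j%:R : R)).
Proof.
move=> j0; have J0 : 0 < j%:R :> R by rewrite ltr0n.
have hj : `|j%:Z| <= j%:Z by rewrite ger0_norm.
set S := Num.sqrt _; have S0 : 0 < S by rewrite sqrtr_gt0.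
have S2 : S ^+ 2 = j%:R by rewrite sqr_sqrtr // ltW.
apply: (@le_trans _ _ (\sum_(i < (2 * j).+1) cbrt S *
  (5 / 6 * P j j%:Z i + (6 * j%:R)^-1 * ((mval i)%:~R ^+ 2 * P j j%:Z i)))).
  apply: ler_sum => i _.
  have -> : cbrt `|(mval i)%:~R : R| = cbrt S * cbrt (`|(mval i)%:~R| / S).
    by rewrite -cbrtM ?divr_ge0 // ?(ltW S0) // mulrCA divff ?mulr1 // gt_eqF.
  rewrite -mulrA; apply: ler_wpM2l; first exact: cbrt_ge0.
  rewrite [leRHS](_ : _ = (5 + (`|(mval i)%:~R| / S) ^+ 2) / 6 * P j j%:Z i); last first.
    by rewrite expr_div_n S2 real_normK ?num_real //; field; rewrite gt_eqF.
  apply: ler_wpM2r; first exact: probJz_ge0.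
  set y := _ / S; have y0 : 0 <= y by rewrite divr_ge0 // ltW.
  (* AM-GM: 6 z <= z^6 + 5 *)
  rewrite -{2}(cbrtK y0); have := cbrt_ge0 y; move: (cbrt y) => z z0.
  rewrite -subr_ge0 [leRHS](_ : _ = (z - 1) ^+ 2
     * (z ^+ 4 + 2 * z ^+ 3 + 3 * z ^+ 2 + 4 * z + 5) / 6); last by field.
  by rewrite divr_ge0 // mulr_ge0 ?sqr_ge0 // !addr_ge0 ?mulr_ge0 ?exprn_ge0.
rewrite -mulr_sumr big_split /= -!mulr_sumr probJz_sum1 // outcome_moment //.
rewrite spin_moment2 sqr_cos_theta // sin_theta // mulrC; apply: ler_wpM2r.
  exact: cbrt_ge0.
rewrite le_eqVlt; apply/orP; left; apply/eqP; rewrite -!pmulrn.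
by field; rewrite gt_eqF.
Qed.

Section Chain.
Variable j : nat.
Hypothesis j0 : (0 < j)%N.
Local Notation n := (2 * j)%N.

Lemma reset_rule_range (i : 'I_n.+1) : exists i' : 'I_n.+1, reset_rule R j (mval i) = mval i'.
Proof.
rewrite /reset_rule; case: ifP => _; last by exists i.
by exists ord_max; rewrite /mval /=; lia.
Qed.

Lemma sum_trans (V : int -> R) m :
  \sum_(i < n.+1) trans R j m (mval i) * V (mval i)
  = \sum_(i < n.+1) V (reset_rule R j (mval i)) * P j m i.
Proof.
under eq_bigr => i _ do rewrite /trans mulr_suml big_mkcond.
rewrite exchange_big; apply: eq_bigr => i _ /=.
have [i' hi'] := reset_rule_range i.
rewrite (bigD1 i') //= hi' eqxx mulrC big1 ?addr0 // => k hk.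
by rewrite ifF //; apply: contraNF hk => /eqP /mval_inj ->.
Qed.

Lemma trans_ge0 m m' : 0 <= trans R j m m'.
Proof. by apply: sumr_ge0 => i _; exact: probJz_ge0. Qed.

Lemma alive_ge0 t m : 0 <= alive R j t m.
Proof.
elim: t m => [|t IH] m /=; first by case: ifP.
by apply: sumr_ge0 => i _; rewrite mulr_ge0 ?trans_ge0.
Qed.

Lemma alive_support t m : m != j%:Z -> Num.sqrt (j%:R : R) < `|m|%:~R ->
  alive R j t m = 0.
Proof.
move=> mj hm; case: t => [|t] /=; first by rewrite (negbTE mj).
apply: big1 => i _; rewrite /trans big1 ?mulr0 // => k /eqP.
rewrite /reset_rule; case: ifPn => [_ E|hk E]; first by rewrite E eqxx in mj.
by rewrite E hm in hk.
Qed.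

Lemma surv_ge0 t : 0 <= surv R j t.
Proof. by apply: sumr_ge0 => i _; exact: alive_ge0. Qed.

(** Foster-Lyapunov argument: the integral W t of V against the sub-distribution [alive] at time t
    stays nonnegative and drops by at least c P(T > t) in each step. Summing over t telescopes. *)
Lemma sum_surv_le (V : int -> R) (c : R) : 0 < c -> (forall m, 0 <= V m) ->
  (forall m, `|m| <= j%:Z -> m != 0 -> m = j%:Z \/ `|m|%:~R <= Num.sqrt (j%:R : R) ->
     \sum_(i < n.+1) V (reset_rule R j (mval i)) * P j m i <= V m - c) ->
  forall T, \sum_(0 <= t < T) surv R j t <= V j%:Z / c.
Proof.
move=> c0 V0 drift T; rewrite ler_pdivlMr //.
pose W t := \sum_(i < n.+1) alive R j t (mval i) * V (mval i).
have W0 t : 0 <= W t by apply: sumr_ge0 => i _; rewrite mulr_ge0 ?alive_ge0.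
have step t : W t.+1 + surv R j t * c <= W t.
  rewrite /W /= /surv mulr_suml.
  under eq_bigr => i _ do rewrite mulr_suml.
  rewrite exchange_big -big_split /=.
  (* The mass that has just reached m = 0 contributes a nonnegative term to W t, which is
     dropped. *)
  rewrite [leRHS](bigID (fun i : 'I_n.+1 => mval i != 0)) /= ler_wpDr //.
    by apply: sumr_ge0 => i _; rewrite mulr_ge0 ?alive_ge0.
  apply: ler_sum => i hi.
  under eq_bigr => k _ do rewrite -mulrA.
  rewrite -mulr_sumr sum_trans -mulrDr.
  (* Where the weight is nonzero, m is reachable: it equals j or is at most sqrt j in absolute
     value. *)
  have [E|hnz] := eqVneq (alive R j t (mval i)) 0; first by rewrite E !mul0r.
  apply: ler_wpM2l; first exact: alive_ge0.
  rewrite -lerBrDr; apply: drift => //.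
    by have := ltn_ord i; rewrite /mval; lia.
  have [->|hij] := eqVneq (mval i) j%:Z; first by left.
  right; rewrite leNgt; apply: contra hnz => h.
  by rewrite (alive_support _ hij h).
have -> : V j%:Z = W 0%N.
  rewrite /W (bigD1 ord_max) //= big1 ?addr0.
    have -> : mval (j := j) ord_max = j%:Z by rewrite /mval /=; lia.
    by rewrite eqxx mul1r.
  move=> i hi; rewrite ifF ?mul0r //; apply: contraNF hi => /eqP E.
  by apply/eqP/mval_inj; rewrite E /mval /=; lia.
suff : W T + (\sum_(0 <= t < T) surv R j t) * c <= W 0%N.
  by apply: le_trans; rewrite lerDr.
elim: T => [|T IH]; first by rewrite big_geq // mul0r addr0.
rewrite big_nat_recr //= mulrDl; apply: le_trans IH.
by rewrite addrCA [leRHS]addrC lerD2l step.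
Qed.

End Chain.
End Drift.

(** * Amplitudes *)

Lemma prod_bits (K : comNzRingType) n (x : 'I_(2 ^ n)) (A B : K) :
  \prod_(l < n) (if qbit x l then A else B) = A ^+ hweight x * B ^+ (n - hweight x).
Proof.
rewrite (bigID (fun l => qbit x l)) /=; congr (_ * _).
  rewrite (eq_bigr (fun=> A)); last by move=> l ->.
  by rewrite prodr_const /hweight cardsE.
rewrite (eq_bigr (fun=> B)); last by move=> l /negbTE ->.
rewrite prodr_const; congr (_ ^+ _); rewrite /hweight cardsE.
by apply/esym; have := cardC (fun l => qbit x l); rewrite card_ord => /(canRL (addKn _)).
Qed.

Section Amplitudes.
Variables (R : realType) (j : nat).
Local Notation n := (2 * j)%N.
Local Notation N := (2 ^ n)%N.
Implicit Types (m : int) (x y : 'I_N).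

Lemma ampE m x : amp R m x = dicke_coef R j m *
  \sum_(y | magn y == m) \prod_(l < n) spin_rot (theta R j m) (qbit x l) (qbit y l).
Proof.
rewrite /amp mxE mulr_sumr [RHS]big_mkcond; apply: eq_bigr => y _.
rewrite !mxE /delta; case: ifP => _; last by rewrite !mulr0.
by rewrite mulr1 mulrC.
Qed.

(* the sum is the coefficient of 'X^w in a product of 2j linear factors, one per
   qubit, each depending only on that bit of x *)
Lemma amp_sym m x x' : `|m| <= j%:Z -> magn x = magn x' -> amp R m x = amp R m x'.
Proof.
move=> hm hx; have {}hx : hweight x = hweight x' by move: hx; rewrite /magn; lia.
rewrite !ampE; congr (_ * _).
set r := spin_rot (theta R j m).
suff H z : \sum_(y | magn y == m) \prod_(l < n) r (qbit z l) (qbit y l)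
    = ((\sum_d (r true d)%:P * 'X^d) ^+ hweight z
       * (\sum_d (r false d)%:P * 'X^d) ^+ (n - hweight z))`_`|j%:Z - m|%N.
  by rewrite !H hx.
rewrite -prod_bits (eq_bigr (fun l => \sum_d (r (qbit z l) d)%:P * 'X^d)); last first.
  by move=> l _; case: (qbit z l).
rewrite -(sum_bits (fun l d => (r (qbit z l) d)%:P * 'X^d)) coef_sum.
rewrite big_mkcond; apply: eq_bigr => y _.
rewrite big_split /= -rmorph_prod -hweight_magn //.
have -> : \prod_(l < n) 'X^(qbit y l) = 'X^(hweight y) :> {poly R}.
  by rewrite hweightE expr_sum.
by rewrite coefCM coefXn eq_sym; case: eqP => _; rewrite ?mulr1 ?mulr0.
Qed.

(** When all contributing strings give the same product, no cancellation can occur. This covers both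
    transitions on which almost sure termination rests. *)
Lemma amp_neq0 m x (v : R) : `|m| <= j%:Z -> v != 0 ->
  (forall y, magn y = m ->
     \prod_(l < n) spin_rot (theta R j m) (qbit x l) (qbit y l) = v) ->
  amp R m x != 0.
Proof.
move=> hm v0 H; rewrite ampE (eq_bigr (fun=> v)); last by move=> y /eqP /H.
have C0 := bin_gt0_magn hm.
rewrite sumr_const -mulr_natl -cardsE card_magn // /dicke_coef.
by rewrite !mulf_neq0 // ?invr_eq0 ?sqrtr_eq0 -?ltNge ?ltr0n ?pnatr_eq0 -?lt0n.
Qed.

Lemma probJz_gt0 m m' x : `|m| <= j%:Z -> magn x = m' -> amp R m x != 0 ->
  0 < probJz m' (rotated R j m).
Proof.
move=> hm hx ha; rewrite probJzE // (bigD1 x) ?hx //=.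
rewrite ltr_wpDr ?exprn_even_gt0 //; apply: sumr_ge0 => y _; exact: sqr_ge0.
Qed.

Lemma magn_surj m : `|m| <= j%:Z -> exists x, magn x = m.
Proof.
move=> hm; have := bin_gt0_magn hm; rewrite -card_magn // card_gt0.
by case/set0Pn => x; rewrite inE => /eqP <-; exists x.
Qed.

Lemma half_angle_neq0 m : (0 < j)%N -> `|m| <= j%:Z -> m != 0 ->
  sin (theta R j m / 2) != 0 /\ cos (theta R j m / 2) != 0.
Proof.
move=> j0 hm m0; have := sin_theta R j0 hm; rewrite sinhalf2 => E.
have : m%:~R / j%:R != 0 :> R.
  by rewrite mulf_neq0 ?intr_eq0 // invr_eq0 pnatr_eq0 -lt0n.
by rewrite -E !mulf_eq0 !negb_or => /andP [/andP [_ ->] ->].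
Qed.

Lemma probJz_top_gt0 m : (0 < j)%N -> `|m| <= j%:Z -> m != 0 ->
  0 < probJz j%:Z (rotated R j m).
Proof.
move=> j0 hm m0; have [s0 c0] := half_angle_neq0 j0 hm m0.
have [x hx] : exists x, magn x = j%:Z by apply: magn_surj; rewrite ger0_norm.
apply: (probJz_gt0 hm hx).
set s := sin _ in s0; set c := cos _ in c0.
apply: (@amp_neq0 _ _ ((- s) ^+ `|j%:Z - m|%N * c ^+ (n - `|j%:Z - m|%N))) => //.
  by rewrite mulf_neq0 // expf_neq0 // oppr_eq0.
move=> y /eqP; rewrite -hweight_magn // => /eqP <-; rewrite -prod_bits.
apply: eq_bigr => l _.
have -> : qbit x l = false.
  have : hweight x = 0%N by move: hx; rewrite /magn; lia.
  by rewrite hweightE => /eqP; rewrite sum_nat_eq0 => /forallP/(_ l); case: (qbit x l).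
by case: (qbit y l).
Qed.

Lemma probJz_zero_gt0 m : (0 < j)%N -> `|m| = j%:Z ->
  0 < probJz 0 (rotated R j m).
Proof.
move=> j0 hmj; have hm : `|m| <= j%:Z by rewrite hmj.
have m0 : m != 0 by move: hmj; lia.
have [s0 c0] := half_angle_neq0 j0 hm m0.
have [x hx] : exists x, magn x = 0 by apply: magn_surj; rewrite normr0.
apply: (probJz_gt0 hm hx).
(* At |m| = j a single basis string occurs, and b is its common bit: 0 for m = j and 1 for m =
   -j. *)
pose b := m < 0.
apply: (@amp_neq0 _ _ (\prod_(l < n) spin_rot (theta R j m) (qbit x l) b)) => //.
  by apply/prodf_neq0 => l _; case: (qbit x l); case: b; rewrite //= oppr_eq0.
move=> y hy; apply: eq_bigr => l _; congr spin_rot.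
have hw := hweight_le y; rewrite /b; move: hy; rewrite /magn => hy.
have [mneg|mpos] := boolP (m < 0).
  have : hweight y = n by lia.
  apply: contra_eqT => /negbTE hl; rewrite neq_ltn; apply/orP; left.
  rewrite hweightE (bigD1 l) //= hl add0n.
  apply: (@leq_ltn_trans (\sum_(i < n | i != l) 1)).
    by apply: leq_sum => i _; case: (qbit y i).
  by rewrite sum1_card cardC1 card_ord; move: (ltn_ord l); lia.
have : hweight y = 0%N by lia.
by rewrite hweightE => /eqP; rewrite sum_nat_eq0 => /forallP/(_ l); case: (qbit y l).
Qed.

(** By [amp_sym] the amplitude is constant on the strings of magnetization 0, so the projection is a
    multiple of the Dicke state; positivity of the outcome probability makes the factor nonzero. *)
Lemma exit_state m : (0 < j)%N -> `|m| <= j%:Z -> 0 < probJz 0 (rotated R j m) ->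
  exists c : R[i], c != 0 /\ projJz 0 (rotated R j m) = c *: dicke R j 0.
Proof.
move=> j0 hm hp.
have h0 : `|0 : int| <= j%:Z by rewrite normr0.
have [x0 hx0] := magn_surj h0.
have D0 : dicke_coef R j 0 != 0.
  have C0 := bin_gt0_magn h0.
  by rewrite /dicke_coef invr_eq0 sqrtr_eq0 -ltNge ltr0n.
have A0 : amp R m x0 != 0.
  apply: contraTneq hp => E; rewrite probJzE // big1 ?ltxx // => y /eqP hy.
  by rewrite (amp_sym hm (etrans hy (esym hx0))) E expr0n.
exists (amp R m x0 / dicke_coef R j 0)%:C; split.
  by rewrite fmorph_eq0 mulf_neq0 // invr_eq0.
apply/matrixP => x i; rewrite ord1 /projJz rotatedE // /dicke /dicke_w !mxE Jz_diag hweight_magn //.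
rewrite -[0]/((0 : int)%:~R) eqr_int; case: eqP => hx; last by rewrite mulr0.
rewrite (amp_sym hm (etrans hx (esym hx0))).
by rewrite -rmorphM /= divfK.
Qed.

End Amplitudes.

(** * Termination and running time *)

Section Termination.
Variables (R : realType) (j : nat).
Hypothesis j0 : (0 < j)%N.
Local Notation n := (2 * j)%N.
Local Notation P m i := (probJz (mval (j := j) i) (rotated R j m)).
Implicit Types (m : int).

Lemma probJz_le1 m (i : 'I_n.+1) : `|m| <= j%:Z -> P m i <= 1.
Proof.
move=> hm; rewrite -(probJz_sum1 R hm) (bigD1 i) //= lerDl.
by apply: sumr_ge0 => k _; exact: probJz_ge0.
Qed.

Lemma mval_max : mval (j := j) ord_max = j%:Z.
Proof. by rewrite /mval /=; lia. Qed.

Lemma mval_abs_le (i : 'I_n.+1) : `|mval i| <= j%:Z.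
Proof. by have := ltn_ord i; rewrite /mval; lia. Qed.

Lemma mval_surj m : `|m| <= j%:Z -> exists i : 'I_n.+1, mval i = m.
Proof.
move=> hm; have hi : (absz (m + j%:Z)%R < n.+1)%N by lia.
by exists (Ordinal hi); rewrite /mval /=; lia.
Qed.

Lemma expect_le1 m (V : int -> R) (i0 : 'I_n.+1) (b0 b : R) : `|m| <= j%:Z ->
  (forall i : 'I_n.+1, V (mval i) <= b) -> V (mval i0) <= b0 ->
  \sum_(i < n.+1) V (mval i) * P m i <= b - (b - b0) * P m i0.
Proof.
move=> hm hb hb0; rewrite (bigD1 i0) //=.
apply: (@le_trans _ _ (b0 * P m i0 + \sum_(i < n.+1 | i != i0) b * P m i)).
  apply: lerD; first by rewrite ler_wpM2r ?probJz_ge0.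
  by apply: ler_sum => i _; rewrite ler_wpM2r ?probJz_ge0.
rewrite -mulr_sumr; have := probJz_sum1 R hm; rewrite (bigD1 i0) //= => E.
have -> : \sum_(i < n.+1 | i != i0) P m i = 1 - P m i0.
  by apply/eqP; rewrite eq_sym subr_eq addrC -E.
by rewrite le_eqVlt; apply/orP; left; apply/eqP; ring.
Qed.

(** Finitely many values of m occur, so the product of the relevant positive probabilities, all at
    most 1, is a common lower bound. The factor 1 stands in where nothing is asked of m. *)
Lemma exit_prob_bound : exists2 d : R, 0 < d <= 1 &
  (forall m, `|m| <= j%:Z -> m != 0 -> d <= probJz j%:Z (rotated R j m)) /\
  (forall m, `|m| = j%:Z -> d <= probJz 0 (rotated R j m)).
Proof.
have [i0 hi0] : exists i : 'I_n.+1, mval i = 0 by apply: mval_surj; rewrite normr0.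
pose f (i : 'I_n.+1) : R := if mval i == 0 then 1 else P (mval i) ord_max.
pose g (i : 'I_n.+1) : R := if `|mval i| == j%:Z then P (mval i) i0 else 1.
have f0 i : 0 < f i <= 1.
  rewrite /f; case: ifPn => hi; first by rewrite ltr01 lexx.
  by rewrite mval_max probJz_top_gt0 ?mval_abs_le //= -mval_max probJz_le1 ?mval_abs_le.
have g0 i : 0 < g i <= 1.
  rewrite /g; case: ifPn => hi; last by rewrite ltr01 lexx.
  by rewrite probJz_le1 ?mval_abs_le // andbT hi0 probJz_zero_gt0 //; exact/eqP.
have prod_bound (h : 'I_n.+1 -> R) : (forall i, 0 < h i <= 1) ->
    0 < \prod_i h i <= 1 /\ forall i, \prod_i h i <= h i.
  move=> hh; have h1 (Q : pred 'I_n.+1) : 0 <= \prod_(i | Q i) h i <= 1.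
    rewrite prodr_ge0 ?prodr_ile1 // => i _; have /andP [/ltW -> //] := hh i.
  split=> [|i].
    by rewrite prodr_gt0 ?(andP (h1 xpredT)).2 // => i _; have /andP [] := hh i.
  have /andP [hi _] := hh i.
  by rewrite (bigD1 i) //= ler_piMr ?(ltW hi) // (andP (h1 _)).2.
have [/andP [F0 F1] Fi] := prod_bound f f0; have [/andP [G0 G1] Gi] := prod_bound g g0.
exists ((\prod_i f i) * \prod_i g i).
  by rewrite mulr_gt0 //= mulr_ile1 // ltW.
split=> [m hm m0|m hm].
  have [i hi] := mval_surj hm.
  apply: (@le_trans _ _ (\prod_i f i)); first by rewrite ler_piMr // ltW.
  by apply: le_trans (Fi i) _; rewrite /f hi (negbTE m0) mval_max.
have [i hi] : exists i : 'I_n.+1, mval i = m by apply: mval_surj; rewrite hm.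
apply: (@le_trans _ _ (\prod_i g i)); first by rewrite ler_piMl // ltW.
by apply: le_trans (Gi i) _; rewrite /g hi hm eqxx hi0.
Qed.

Lemma reset_rule_top : reset_rule R j j%:Z = j%:Z.
Proof. by rewrite /reset_rule; case: ifP. Qed.

Lemma reset_rule0 : reset_rule R j 0 = 0.
Proof. by rewrite /reset_rule normr0 ltNge sqrtr_ge0. Qed.

(** This holds for every j >= 1, with a rate that depends on j: the potential is 0 at m = 0, 1 at
    |m| = j and 1 + d/2 elsewhere, and it loses at least d^2 / 2 per step. The survival
    probabilities are then summable, hence tend to 0. *)
Lemma surv_cvg0 : (surv R j @ \oo --> (0 : R))%classic.
Proof.
have [d /andP [d0 d1] [dtop dzero]] := exit_prob_bound.
(* from |m| < j the run restarts, and from |m| = j it stops, with probability at least d *)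
pose V m : R := if m == 0 then 0 else if `|m| == j%:Z then 1 else 1 + d / 2.
have h0 : 0 <= 1 + d / 2 by lra.
have h1 : 1 <= 1 + d / 2 by lra.
have V0 m : 0 <= V m by rewrite /V; case: (m == 0); case: (`|m| == j%:Z); rewrite ?lexx ?ler01.
have V1 m : V m <= 1 + d / 2 by rewrite /V; case: (m == 0); case: (`|m| == j%:Z); rewrite ?lexx.
have drift m : `|m| <= j%:Z -> m != 0 -> m = j%:Z \/ `|m|%:~R <= Num.sqrt (j%:R : R) ->
    \sum_(i < n.+1) V (reset_rule R j (mval i)) * P m i <= V m - d ^+ 2 / 2.
  move=> hm m0 _; rewrite /V (negbTE m0) -/(V _); case: ifPn => [/eqP hj|hj].
    have [i0 hi0] : exists i : 'I_n.+1, mval i = 0 by apply: mval_surj; rewrite normr0.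
    apply: le_trans (@expect_le1 m (fun k => V (reset_rule R j k)) i0 0 _ hm (fun i => V1 _) _) _.
      by rewrite hi0 reset_rule0 /V eqxx.
    by rewrite hi0; have := dzero m hj; nra.
  apply: le_trans (@expect_le1 m (fun k => V (reset_rule R j k)) ord_max 1 _ hm (fun i => V1 _) _) _.
    by rewrite mval_max reset_rule_top /V ger0_norm // eqxx; case: ifP.
  by rewrite mval_max; have := dtop m hm m0; nra.
have d2 : 0 < d ^+ 2 / 2 by nra.
have H := sum_surv_le j0 d2 V0 drift.
apply: cvg_series_cvg_0; apply: nondecreasing_is_cvgn.
  by apply: nondecreasing_series => t _ _; exact: surv_ge0.
by exists (V j%:Z / (d ^+ 2 / 2)) => _ [T _ <-]; exact: H.
Qed.

Lemma expected_iterations_le (B : R) :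
  (forall T, \sum_(0 <= t < T) surv R j t <= B) ->
  (expected_iterations R j <= B%:E)%E.
Proof.
move=> H; apply: lime_le.
  by apply: is_cvg_nneseries => t _ _; rewrite lee_fin surv_ge0.
by near=> T; rewrite sumEFin lee_fin.
Unshelve. all: by end_near. Qed.

Lemma ln1D_le_tangent (y z : R) : 0 <= y -> 0 <= z ->
  ln (1 + y) <= ln (1 + z) + (y - z) / (1 + z).
Proof.
move=> y0 z0; have z1 : 0 < 1 + z by lra.
have y1 : 0 < 1 + y by lra.
rewrite -lerBlDl -ln_div ?posrE //.
have E : (1 + y) / (1 + z) = 1 + (y - z) / (1 + z) by field; rewrite gt_eqF.
by rewrite E; apply: le_ln1Dx; rewrite -subr_gt0 opprK addrC -E divr_gt0.
Qed.

(** The value a = 500 makes the logarithmic part lose a/250 * z/(1+z) >= 1 for z >= 1. After a reset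
    the mean potential is at most 2 a ln j + 11/12 B; taking B = 12 (2 a + 2) ln j leaves a drop of
    2 ln j, at least 1 because ln j >= 1/2. *)
Lemma surv_sum_log : (64 * 64 <= j)%N ->
  forall T, \sum_(0 <= t < T) surv R j t <= 12 * (2 * 500 + 2) * ln (j%:R : R).
Proof.
move=> hj; have J0 : 0 < j%:R :> R by rewrite ltr0n.
have J64 : 64 * 64 <= j%:R :> R by rewrite -natrM ler_nat.
have he : j%:R^-1 <= 1 / 64 / 64 :> R.
  by rewrite -[1 / 64 / 64]invrK lef_pV2 ?posrE ?invr_gt0 //; lra.
have lnj : 1 / 2 <= ln (j%:R : R).
  have : ln (1 + (j%:R^-1 - 1)) <= j%:R^-1 - 1 :> R.
    by apply: le_ln1Dx; rewrite ltrBrDr addNr invr_gt0.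
  by rewrite addrC subrK lnV ?posrE //; lra.
set S := Num.sqrt (j%:R : R); have S0 : 0 < S by rewrite sqrtr_gt0.
have S2 : S ^+ 2 = j%:R by rewrite sqr_sqrtr // ltW.
have Sj : S < j%:R by rewrite -S2 expr2 ltr_pMr //; nra.
have cS0 : 0 < cbrt S by rewrite powR_gt0.
pose F (m : int) : R := cbrt `|m%:~R|; have F0 m : 0 <= F m by exact: cbrt_ge0.
(* a and B are kept opaque: unification would otherwise unfold the numerals *)
have [a aE] : exists a : R, a = 500 by exists 500.
have a0 : 0 <= a by rewrite aE ler0n.
have [B BE] : exists B : R, B = 12 * (2 * a + 2) * ln j%:R by eexists.
have B0 : 0 <= B by rewrite BE; apply: mulr_ge0; lra.
pose V m : R := if S < `|m|%:~R then B else a * ln (1 + F m) + B * (F m / cbrt S).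
have ln0 m : 0 <= ln (1 + F m) by rewrite ln_ge0 // lerDl.
have V0 m : 0 <= V m.
  rewrite /V; case: ifP => _ //.
  by rewrite addr_ge0 // mulr_ge0 // divr_ge0 // ltW.
have VT : V j%:Z = B by rewrite /V ger0_norm // -pmulrn Sj.
(* A reset occurs only for |m| > sqrt j, where F m / cbrt S >= 1, so the formula without reset
   already dominates B. *)
have Vle (c : R) (m : int) : a * ln (1 + F m) <= c -> 
    V (reset_rule R j m) <= c + B * (F m / cbrt S).
  move=> hc; rewrite /reset_rule -/S; case: ifPn => [hS|hS].
    rewrite VT; have c0 : 0 <= c by apply: le_trans hc; rewrite mulr_ge0.
    apply: ler_wpDl => //; rewrite ler_peMr // ler_pdivlMr // mul1r.
    by apply: le_cbrt; [exact: ltW | rewrite -intr_norm ltW].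
  by rewrite /V (negbTE hS) lerD2r.
rewrite -aE -BE -VT -[V _]divr1 => T.
apply: sum_surv_le => // m hm m0 hmS.
have [mj|mj] := eqVneq m j%:Z.
  rewrite mj VT.
  (* A crude bound suffices: 1 + F <= 1 + (j + 2) / 3 <= j^2. *)
  have lnle (i : 'I_n.+1) : a * ln (1 + F (mval i)) <= a * (2 * ln j%:R).
    rewrite ler_wpM2l //.
    have <- : ln ((j%:R : R) ^+ 2) = 2 * ln j%:R by rewrite lnXn // mulr_natl.
    rewrite ler_ln ?posrE ?exprn_gt0 ?ltr_wpDr //.
    have hF := cbrt_le_tangent (normr_ge0 ((mval i)%:~R : R)).
    have hi : `|(mval i)%:~R| <= j%:R :> R by rewrite -intr_norm pmulrn ler_int mval_abs_le.
    rewrite -/(F (mval i)) in hF.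
    by move: (F _) (`|_|) hF hi => f y hF hi; nra.
  apply: (@le_trans _ _ (\sum_(i < n.+1)
     (a * (2 * ln j%:R) * P j%:Z i + B / cbrt S * (F (mval i) * P j%:Z i)))).
    apply: ler_sum => i _; rewrite [leRHS](_ : _ =
      (a * (2 * ln j%:R) + B * (F (mval i) / cbrt S)) * P j%:Z i); last by ring.
    by rewrite ler_wpM2r ?probJz_ge0 // (Vle _ _ (lnle i)).
  rewrite big_split /= -!mulr_sumr probJz_sum1 ?ger0_norm // mulr1.
  have k0 : 0 <= B / cbrt S by rewrite divr_ge0 // ltW.
  apply: le_trans (lerD (lexx _) (ler_wpM2l k0 (cbrt_initial R j0))) _.
  rewrite -/S (_ : B / cbrt S * _ = 11 / 12 * B); last by field; rewrite gt_eqF.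
  by rewrite BE; move: (ln _) lnj => L lnj; lra.
have {hmS} hmS : `|m|%:~R <= S by case: hmS => // E; rewrite E eqxx in mj.
have hm2 : m%:~R ^+ 2 <= j%:R :> R.
  by rewrite -S2 -real_normK ?num_real // -intr_norm lerXn2r ?nnegrE ?ler0z // ltW.
have C := cbrt_contraction j0 he m0 hm2; rewrite -/(F m) in C.
have Fm1 : 1 <= F m.
  have <- : cbrt (1 : R) = 1 by rewrite /cbrt powR1.
  apply: le_cbrt => //.
  by rewrite -intr_norm (_ : 1 = 1%:~R) // ler_int; clear -m0; lia.
set z := F m in C Fm1 *.
have z1 : 0 < 1 + z by lra.
(* By concavity the tangent of ln at 1 + z bounds the summand by an expression affine in F, to which
   [cbrt_contraction] applies. *)
apply: (@le_trans _ _ (\sum_(i < n.+1)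
   (a * (ln (1 + z) - z / (1 + z)) * P m i
    + (a / (1 + z) + B / cbrt S) * (F (mval i) * P m i)))).
  apply: ler_sum => i _.
  rewrite [leRHS](_ : _ = (a * (ln (1 + z) + (F (mval i) - z) / (1 + z))
     + B * (F (mval i) / cbrt S)) * P m i); last by field; rewrite !gt_eqF.
  apply: ler_wpM2r; first exact: probJz_ge0.
  apply: Vle; rewrite ler_wpM2l //; apply: ln1D_le_tangent => //.
  exact: F0.
rewrite big_split /= -!mulr_sumr probJz_sum1 // mulr1.
have k0 : 0 <= a / (1 + z) + B / cbrt S.
  by rewrite addr_ge0 // divr_ge0 // ltW.
apply: le_trans (lerD (lexx _) (ler_wpM2l k0 C)) _.
rewrite /V ltNge hmS /= -/z.
rewrite [leLHS](_ : _ = a * ln (1 + z) - a / 250 * (z / (1 + z))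
  + 249 / 250 * (B * (z / cbrt S))); last by field; rewrite !gt_eqF.
have hz : 1 / 2 <= z / (1 + z) by rewrite ler_pdivlMr //; lra.
have hr : 0 <= B * (z / cbrt S) by rewrite mulr_ge0 // divr_ge0 // ltW // (lt_le_trans ltr01).
by rewrite aE; move: (ln _) (z / (1 + z)) (B * _) hz hr => L q r hz hr; lra.
Qed.

End Termination.

Local Open Scope classical_set_scope.

Theorem theorem1 (R : realType) :
  (* the loop terminates almost surely, for every j >= 1 *)
  (forall j : nat, (0 < j)%N -> (surv R j) @ \oo --> (0 : R)) /\
  (* when the loop exits (outcome m = 0), the system is in |j,0>
     (the post-measurement state is a nonzero multiple of |j,0>) *)
  (forall (j : nat) (m : int), (0 < j)%N -> `|m| <= j%:Z ->
     0 < probJz 0 (rotated R j m) ->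
     exists c : R[i], c != 0 /\ projJz 0 (rotated R j m) = c *: dicke R j 0) /\
  (* expected number of iterations is O(log j) *)
  (exists (K : R) (J0 : nat), forall j : nat, (J0 <= j)%N ->
     (expected_iterations R j <= (K * ln (j%:R : R))%:E)%E).
Proof.
split; first by move=> j; exact: surv_cvg0.
split; first by move=> j m; exact: exit_state.
exists (12 * (2 * 500 + 2)), (64 * 64)%N => j hj.
by apply: expected_iterations_le; apply: surv_sum_log => //; lia.
Qed.
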